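(* Every orthogonal bundle $V$ over $C$ (with values in an arbitrary line bundle $L$) of odd rank $2n+1\ge 1$ admits an isotropic subbundle of rank $n$.
   Context: $C$ is a smooth complex projective curve of genus $g \ge 2$. An ($L$-valued) orthogonal bundle is a vector bundle $V$ over $C$ with a nondegenerate symmetric bilinear form $\sigma\colon V\otimes V\to L$, where $L$ is a line bundle. A subbundle $E\subset V$ is isotropic if $\sigma|_{E\otimes E}\equiv 0$. *)

(* Defs.v *)
From HB Require Import structures.
From mathcomp Require Import all_boot all_order all_algebra.
From mathcomp Require Export mpoly complex reals.

Set Implicit Arguments.
Unset Strict Implicit.
Unset Printing Implicit Defensive.

Import GRing.Theory.
Local Open Scope ring_scope.

(* P^N(F) is the set of lines through the origin of F^(N+1); [rep x] is a      *)
(* nonzero vector of the line x, i.e. a choice of homogeneous coordinates.     *)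
(* Zero loci of forms, and quotients of two forms of the same degree, do not   *)
(* depend on that choice.                                                      *)
Definition proj_space (F : fieldType) (N : nat) :=
  {U : {vspace 'rV[F]_N.+1} | \dim U == 1}.

Definition rep (F : fieldType) N (x : proj_space F N) : 'rV[F]_N.+1 :=
  vpick (val x).

Definition evalp (F : fieldType) N (p : {mpoly F[N.+1]})
  (x : proj_space F N) : F := p.@[rep x 0].

Definition form (F : fieldType) N (p : {mpoly F[N.+1]}) : Prop :=
  exists d : nat, p \is d.-homog.

Section Loci.
Variables (F : fieldType) (N : nat) (eqs : seq {mpoly F[N.+1]}).

Definition zero_locus := {x : proj_space F N | all (fun f => evalp f x == 0) eqs}.

Definition zclosed (Z : zero_locus -> Prop) : Prop :=
  exists2 T : {mpoly F[N.+1]} -> Prop, (forall f, T f -> form f) &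
    forall x, Z x <-> (forall f, T f -> evalp f (val x) = 0).

Definition zopen (U : zero_locus -> Prop) : Prop := zclosed (fun x => ~ U x).

Definition zirreducible (Z : zero_locus -> Prop) : Prop :=
  (exists x, Z x) /\
  forall A B, zclosed A -> zclosed B -> (forall x, Z x -> A x \/ B x) ->
    (forall x, Z x -> A x) \/ (forall x, Z x -> B x).

Definition irreducible_chain (d : nat) : Prop :=
  exists Z : nat -> zero_locus -> Prop,
    (forall i, (i <= d)%N -> zclosed (Z i) /\ zirreducible (Z i)) /\
    (forall i, (i < d)%N ->
       (forall x, Z i x -> Z i.+1 x) /\ exists x, Z i.+1 x /\ ~ Z i x).

Definition has_dimension (d : nat) : Prop :=
  irreducible_chain d /\ ~ irreducible_chain d.+1.

(* With [form_eqs], [eqs] generates the homogeneous ideal of its zero locus.   *)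
Definition generates_vanishing_ideal : Prop :=
  forall f, form f -> (forall x : zero_locus, evalp f (val x) = 0) ->
    exists h : 'I_(size eqs) -> {mpoly F[N.+1]},
      f = \sum_(i < size eqs) h i * eqs`_i.

Definition grad (p : {mpoly F[N.+1]}) (v : 'rV[F]_N.+1) : 'rV[F]_N.+1 :=
  \row_j (p^`M(j)).@[v 0].

Definition jacobian (x : zero_locus) : 'M[F]_(size eqs, N.+1) :=
  \matrix_(i < size eqs) grad eqs`_i (rep (val x)).

End Loci.

(* Smooth irreducible projective curves; smoothness is the Jacobian criterion  *)
(* rank = N - dim for generators of the homogeneous ideal.                     *)
Record curve (F : closedFieldType) := Curve {
  ambient_dim : nat;
  equations : seq {mpoly F[ambient_dim.+1]};
  equations_form : forall f, f \in equations -> form f;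
  equations_ideal : generates_vanishing_ideal equations;
  curve_irreducible : zirreducible (fun _ : zero_locus equations => True);
  curve_dim1 : has_dimension equations 1;
  curve_smooth : forall x : zero_locus equations,
    (\rank (jacobian x) + 1 = ambient_dim)%N
}.

Definition points (F : closedFieldType) (C : curve F) : Type :=
  zero_locus (equations C).
Coercion points : curve >-> Sortclass.

Section Functions.
Variables (F : closedFieldType) (C : curve F).

Definition opn (U : C -> Prop) : Prop := @zopen F _ (equations C) U.

Definition ev (p : {mpoly F[(ambient_dim C).+1]}) (x : C) : F :=
  evalp p (val (x : zero_locus (equations C))).

Definition regular_on (U : C -> Prop) (f : C -> F) : Prop :=
  forall x, U x ->
    exists W : C -> Prop, [/\ opn W, W x &
      exists d (p q : {mpoly F[(ambient_dim C).+1]}),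
        [/\ p \is d.-homog, q \is d.-homog &
          forall y, W y -> U y -> ev q y <> 0 /\ f y = ev p y / ev q y]].

(* Covectors are rows on F^(N+1).  The cotangent space of C at x is the space  *)
(* of rows killing the line x modulo the row space of the Jacobian matrix; the *)
(* differential of p / q, for forms p and q of equal degree, is given by the   *)
(* quotient rule and kills the line x by Euler's identity.                     *)
Definition coords (x : C) : 'rV[F]_(ambient_dim C).+1 :=
  rep (val (x : zero_locus (equations C))).

Definition eq_covector (x : C) (xi eta : 'rV[F]_(ambient_dim C).+1) : Prop :=
  (xi - eta <= jacobian (x : zero_locus (equations C)))%MS.

Definition dquot (p q : {mpoly F[(ambient_dim C).+1]}) (x : C) :
    'rV[F]_(ambient_dim C).+1 :=
  (ev q x) ^- 2 *: (ev q x *: grad p (coords x) - ev p x *: grad q (coords x)).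

(* Global sections of the canonical bundle: locally sum_k a_k d(p_k / q_k)     *)
(* with a_k and p_k / q_k regular.                                             *)
Definition regular_1form (w : C -> 'rV[F]_(ambient_dim C).+1) : Prop :=
  forall x, exists W : C -> Prop, [/\ opn W, W x &
    exists m (a : 'I_m -> C -> F) (d : 'I_m -> nat)
        (p q : 'I_m -> {mpoly F[(ambient_dim C).+1]}),
      (forall k, [/\ regular_on W (a k), p k \is (d k).-homog,
                     q k \is (d k).-homog & forall y, W y -> ev (q k) y <> 0]) /\
      forall y, W y ->
        eq_covector y (w y) (\sum_(k < m) a k y *: dquot (p k) (q k) y)].

(* g = dim H^0(C, K_C) *)
Definition has_genus (g : nat) : Prop :=
  exists w : 'I_g -> C -> 'rV[F]_(ambient_dim C).+1,
    (forall k, regular_1form (w k)) /\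
    forall eta, regular_1form eta ->
      exists! c : 'rV[F]_g,
        forall x, eq_covector x (eta x) (\sum_(k < g) c 0 k *: w k x).

End Functions.

(* Algebraic vector bundles of rank r: a family of vector spaces with an atlas *)
(* of fibrewise linear trivializations over Zariski open sets whose transition *)
(* matrices have regular entries (the inverse matrix being the transition in   *)
(* the other direction).  Charts are irrelevant outside their domain.          *)
Record vbundle (F : closedFieldType) (C : curve F) (r : nat) := VBundle {
  fiber : C -> vectType F;
  chart_index : Type;
  chart_dom : chart_index -> C -> Prop;
  chart : chart_index -> forall x : C, {linear fiber x -> 'rV[F]_r};
  chart_open : forall i, opn (chart_dom i);
  chart_cover : forall x, exists i, chart_dom i x;
  chart_bij : forall i x, chart_dom i x -> bijective (chart i x);
  chart_change : forall i j, exists g : C -> 'M[F]_r,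
    (forall k l, regular_on (fun x => chart_dom i x /\ chart_dom j x)
                            (fun x => g x k l)) /\
    forall x, chart_dom i x -> chart_dom j x ->
      forall v, chart j x v = chart i x v *m g x
}.

Section Bundles.
Variables (F : closedFieldType) (C : curve F).

Definition regular_section r (V : vbundle C r) (U : C -> Prop)
    (s : forall x, fiber V x) : Prop :=
  forall (i : chart_index V) (k : 'I_r),
    regular_on (fun x => U x /\ chart_dom i x) (fun x => chart i x (s x) 0 k).

Record orthogonal_bundle (L : vbundle C 1) (r : nat) := OrthogonalBundle {
  obundle : vbundle C r;
  oform : forall x : C,
    {bilinear fiber obundle x -> fiber obundle x -> fiber L x};
  oform_regular : forall (U : C -> Prop) (s t : forall x, fiber obundle x),
    opn U -> regular_section U s -> regular_section U t ->
    regular_section U (fun x => oform x (s x) (t x));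
  oform_sym : forall x u v, oform x u v = oform x v u;
  oform_nondeg : forall x u, (forall v, oform x u v = 0) -> u = 0
}.

(* Fibrewise linear independence of the local frame makes the quotient a       *)
(* bundle: this is a subbundle, not merely a locally free subsheaf.            *)
Definition subbundle r (V : vbundle C r) (n : nat)
    (E : forall x, {vspace fiber V x}) : Prop :=
  forall x, exists W : C -> Prop, [/\ opn W, W x &
    exists s : 'I_n -> forall y, fiber V y,
      (forall k, regular_section W (s k)) /\
      forall y, W y -> basis_of (E y) [tuple s k y | k < n]].

Definition isotropic (L : vbundle C 1) r (V : orthogonal_bundle L r)
    (E : forall x, {vspace fiber (obundle V) x}) : Prop :=
  forall x u v, u \in E x -> v \in E x -> oform V x u v = 0.

End Bundles.

(* Main.v *)
Require Import Defs.
From HB Require Import structures.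
From mathcomp Require Import all_boot all_order all_algebra.
From mathcomp Require Import generic_quotient ring_quotient fraction boolp.
From mathcomp Require Import ring zify.

(** The function field [K] of the curve is C1 (Tsen's theorem), so that a
    quadratic form in at least three variables over [K] has a nontrivial zero.
    The generic fibre of [V] is a quadratic space of dimension [2 * n + 1] over
    [K]; as long as an isotropic subspace [W] has dimension less than [n], the
    quotient of its orthogonal by [W] has dimension at least three and contains
    an isotropic line. This yields an isotropic subspace of dimension [n] of the
    generic fibre ([isotropic_subspace_exists]). As the curve is smooth, its
    local rings are valuation rings, hence such a subspace extends uniquely to a
    subbundle ([saturated_subbundle]), which is isotropic because it is so
    generically.

    Tsen's theorem ([tsen_ternary]) comes from counting dimensions. For a
    ternary quadratic form with coefficients of degree [e], a zero whose entries
    are forms of degree [d] on the curve is a solution of a system of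
    [H (2 * d + e)] homogeneous quadratic equations in [3 * H d] unknowns over
    the base field, where [H] is the Hilbert function of the curve. Since [H] grows at most linearly
    ([hilbert_linear]), there are more unknowns than equations for some [d], and
    then there is a nontrivial solution ([quadrics_common_zero]). Both facts
    rest on the projective Nullstellensatz ([projective_nullstellensatz]): the
    linear bound holds because two linear forms without common zero on the
    curve generate all forms of high degree, and a system of quadrics without
    nontrivial zero would make the polynomial ring finite over the subring
    generated by too few elements. That two linear forms suffice reflects
    dimension one, in the form that proper closed subsets are finite
    ([clsd_finite]).

    For the local rings ([regular_at_valuation]), the Jacobian criterion and
    Nakayama's lemma show that the maximal ideal is principal, and the Noetherian
    property, obtained from Dickson's lemma ([ideal_maximal]), excludes nonzero
    elements that are divisible by all the powers of its generator. *)

Set Implicit Arguments.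
Unset Strict Implicit.
Unset Printing Implicit Defensive.

Import Order.TTheory GRing.Theory.
Local Open Scope ring_scope.

(** * Noetherianity of polynomial rings *)

Lemma monotone_subseq (u : nat -> nat) :
  exists2 f : nat -> nat, {homo f : i j / (i < j)%N} &
    forall i j, (i <= j)%N -> (u (f i) <= u (f j))%N.
Proof.
have next N : {k | (N <= k)%N & forall j, (N <= j)%N -> (u k <= u j)%N}.
  have exP : exists m, `[< exists2 k, (N <= k)%N & u k = m >].
    by exists (u N); apply/asboolP; exists N.
  case: (ex_minnP exP) => m /asboolP exk min_m.
  case: (cid2 exk) => k leNk ukm; exists k => // j leNj.
  by rewrite ukm; apply: min_m; apply/asboolP; exists j.
pose g N := s2val (next N); pose f := fix f i := if i is i'.+1 then g (f i').+1 else g 0%N.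
have gP N : (N <= g N)%N by rewrite /g; case: (next N).
have gmin N l : (N <= l)%N -> (u (g N) <= u l)%N by rewrite /g; case: (next N) => k /= _; apply.
have fS i : (f i < f i.+1)%N by exact: gP.
have f_mono : {homo f : i j / (i < j)%N} by apply: homo_ltn => //; exact: ltn_trans.
exists f => // i j leij.
have minf : forall j, (f i <= j)%N -> (u (f i) <= u j)%N.
  move=> l; case: i {leij} => [|i] lel; apply: gmin => //.
  exact: leq_trans (gP _) lel.
by apply: minf; case: ltngtP leij => // [/f_mono/ltnW|->].
Qed.

(** Dickson's lemma, by extracting successively, for each variable, a
    subsequence along which its exponent is nondecreasing. *)
Lemma dickson n (a : nat -> 'X_{1..n}) :
  exists i j, (i < j)%N /\ (a i <= a j)%MM.
Proof.
have sub k : (k <= n)%N -> exists2 f : nat -> nat, {homo f : i j / (i < j)%N} &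
    forall (l : 'I_n) i j, (l < k)%N -> (i <= j)%N -> (a (f i) l <= a (f j) l)%N.
  elim: k => [|k IHk] lekn; first by exists id.
  case: (IHk (ltnW lekn)) => f f_mono fP.
  case: (monotone_subseq (fun i => a (f i) (Ordinal lekn))) => h h_mono hP.
  exists (f \o h) => [i j /h_mono/f_mono//|l i j].
  rewrite ltnS leq_eqVlt => /orP[/eqP lk|ltlk] leij /=.
    by have -> : l = Ordinal lekn by [apply: val_inj]; exact: hP.
  apply: fP => //; move: leij; rewrite leq_eqVlt => /orP[/eqP->//|/h_mono/ltnW//].
case: (sub n (leqnn n)) => f f_mono fP.
exists (f 0%N), (f 1%N); split; first exact: f_mono.
by apply/mnm_lepP => l; apply: fP.
Qed.

Section Ideals.
Variables (F : fieldType) (n : nat).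
Implicit Types (I J : {mpoly F[n]} -> Prop) (p q : {mpoly F[n]}).

Definition is_ideal I : Prop :=
  [/\ I 0, forall p q, I p -> I q -> I (p + q) & forall p q, I q -> I (p * q)].

Lemma idealN I p : is_ideal I -> I p -> I (- p).
Proof. by case=> _ _ IM Ip; rewrite -mulN1r; apply: IM. Qed.

Lemma idealB I p q : is_ideal I -> I p -> I q -> I (p - q).
Proof. by move=> idI Ip Iq; case: (idI) => _ ID _; apply: ID => //; apply: idealN. Qed.

Lemma ideal_sum I (T : Type) (r : seq T) (P : pred T) (f : T -> {mpoly F[n]}) :
  is_ideal I -> (forall i, P i -> I (f i)) -> I (\sum_(i <- r | P i) f i).
Proof. by case=> I0 ID _ If; elim/big_ind: _. Qed.

(** An infinite strictly ascending chain would give elements [f i] of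
    [I (i + 1)] outside [I i] with least possible leading monomial; by Dickson's
    lemma the leading monomial of some [f i] divides that of a later [f j],
    and cancelling the leading term of [f j] contradicts minimality. *)
Lemma ideal_maximal (P : ({mpoly F[n]} -> Prop) -> Prop) :
  (forall I, P I -> is_ideal I) -> (exists I, P I) ->
  exists2 I, P I & forall J, P J -> (forall p, I p -> J p) -> forall p, J p -> I p.
Proof.
move=> idP exP; apply: contrapT => noMax.
have step (I : {I | P I}) : {Jf : {J | P J} * {mpoly F[n]} |
    [/\ forall p, sval I p -> sval Jf.1 p, sval Jf.1 Jf.2, ~ sval I Jf.2 &
      forall g, sval Jf.1 g -> ~ sval I g -> ~~ (mlead g < mlead Jf.2)%O]}.
  apply: cid; case: I => I PI /=; apply: contrapT => noJ; apply: noMax.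
  exists I => // J PJ sIJ p Jp; apply: contrapT => nIp; apply: noJ.
  pose Q m := exists g, [/\ J g, ~ I g & mlead g = m].
  have [m [[g [Jg nIg gm]] minm]] : exists m, Q m /\ forall m', Q m' -> ~~ (m' < m)%O.
    have : Q (mlead p) by exists p.
    elim/(well_founded_ind (@ltom_wf n)): (mlead p) => m IH Qm.
    case: (pselect (exists2 m', Q m' & (m' < m)%O)) => [[m' Qm' lt]|no].
      exact: (IH m' lt Qm').
    by exists m; split=> // m' Qm'; apply/negP => lt; apply: no; exists m'.
  exists (exist P J PJ, g) => /=; split=> // h Jh nIh.
  by rewrite gm; apply: minm; exists h.
have [I0 PI0] := cid exP.
pose c := fix c i : {I | P I} := if i is i'.+1 then (sval (step (c i'))).1
                     else exist P I0 PI0.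
pose f i := (sval (step (c i))).2.
have cS i p : sval (c i) p -> sval (c i.+1) p by rewrite /=; case: (step _) => -[J g] /= [h _ _ _]; exact: h.
have fS i : sval (c i.+1) (f i) by rewrite /f /=; case: (step _) => -[J g] /= [_ h _ _].
have fN i : ~ sval (c i) (f i) by rewrite /f /=; case: (step _) => -[J g] /= [_ _ h _].
have fmin i g : sval (c i.+1) g -> ~ sval (c i) g -> ~~ (mlead g < mlead (f i))%O.
  by rewrite /f /=; case: (step _) => -[J h] /= [_ _ _ H]; exact: H.
have cle i j p : (i <= j)%N -> sval (c i) p -> sval (c j) p.
  by move/subnK <-; elim: (j - i)%N => // k IH /IH; rewrite addSn; apply: cS.
have idc i : is_ideal (sval (c i)) by exact: (idP _ (svalP (c i))).
have f0 i : f i != 0.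
  by apply/eqP=> fi0; apply: (fN i); rewrite fi0; case: (idc i).
case: (dickson (fun i => mlead (f i))) => i [j [ltij lead_ij]].
pose q : {mpoly F[n]} := ((f j)@_(mlead (f j)) / (f i)@_(mlead (f i))) *: 'X_[mlead (f j) - mlead (f i)] * f i.
have cjq : sval (c j) q.
  by case: (idc j) => _ _; apply; apply: (cle i.+1).
have nz i' : (f i')@_(mlead (f i')) != 0 by rewrite mleadc_eq0.
have nzc : (f j)@_(mlead (f j)) / (f i)@_(mlead (f i)) != 0.
  by rewrite mulf_neq0 ?invr_eq0.
have X0 : 'X_[F, mlead (f j) - mlead (f i)] != 0 by rewrite -msupp_eq0 msuppX.
have mleadX m : mlead 'X_[F, m] = m by exact: mleadXm.
have lq : mlead q = mlead (f j).
  rewrite /q -scalerAl mleadZ // mleadM // mleadX.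
  exact: submK.
have lcq : q@_(mlead q) = (f j)@_(mlead (f j)).
  by rewrite /q -!scalerAl mcoeffZ mleadZ // mleadM // mleadcM mleadX mcoeffX eqxx mul1r divfK.
have cjS : sval (c j.+1) (f j - q) by apply: idealB => //; apply: cS.
have ncj : ~ sval (c j) (f j - q).
  move=> h; apply: (fN j); rewrite -(subrK q (f j)).
  by case: (idc j) => _ D _; apply: D.
have /negP := fmin j _ cjS ncj; apply.
have nz2 : f j - q != 0 by apply/eqP=> e; apply: ncj; rewrite e; case: (idc j).
have : (mlead (f j - q) <= mlead (f j))%O.
  by apply: le_trans (mleadB_le _ _) _; rewrite lq joinxx.
rewrite le_eqVlt => /orP[/eqP e|//].
have := mleadc_eq0 (f j - q); rewrite (negPf nz2) e mcoeffB -{2}lq lcq subrr eqxx.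
by [].
Qed.

End Ideals.

(** * Linear independence modulo a subspace *)

Section Independence.
Variables (F : fieldType) (V : lmodType F) (N : V -> Prop).

Definition is_subspace : Prop :=
  [/\ N 0, forall u v, N u -> N v -> N (u + v) & forall a u, N u -> N (a *: u)].

Definition free_mod (J : finType) (b : J -> V) : Prop :=
  forall c : J -> F, N (\sum_j c j *: b j) -> forall j, c j = 0.

Definition span_mod (J : finType) (b : J -> V) (v : V) : Prop :=
  exists c : J -> F, N (v - \sum_j c j *: b j).

Hypothesis subN : is_subspace.

Lemma span_mod_gen (J : finType) (b : J -> V) j : span_mod b (b j).
Proof.
case: subN => N0 _ _; exists (fun i => (i == j)%:R).
rewrite (bigD1 j) //= eqxx scale1r big1 ?addr0 ?subrr // => i /negPf ->.
by rewrite scale0r.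
Qed.

Lemma span_mod_sub (J : finType) (b : J -> V) u : N u -> span_mod b u.
Proof.
by move=> Nu; exists (fun=> 0); rewrite big1 ?subr0 // => j _; rewrite scale0r.
Qed.

Lemma span_modZ (J : finType) (b : J -> V) a u : span_mod b u -> span_mod b (a *: u).
Proof.
case: subN => _ _ NZ [c Nc]; exists (fun j => a * c j).
under eq_bigr do rewrite -scalerA.
by rewrite -scaler_sumr -scalerBr; apply: NZ.
Qed.

Lemma span_modD (J : finType) (b : J -> V) u v :
  span_mod b u -> span_mod b v -> span_mod b (u + v).
Proof.
case: subN => _ ND _ [c Nc] [d Nd]; exists (fun j => c j + d j).
under eq_bigr do rewrite scalerDl.
by rewrite big_split /= opprD addrACA; apply: ND.
Qed.

Lemma span_mod_sum (J : finType) (b : J -> V) (I : Type) (r : seq I) (P : pred I) (f : I -> V) :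
  (forall i, P i -> span_mod b (f i)) -> span_mod b (\sum_(i <- r | P i) f i).
Proof.
move=> fP; elim/big_ind: _ => //; last exact: span_modD.
by apply: span_mod_sub; case: subN.
Qed.

Lemma span_mod_trans (J J' : finType) (b : J -> V) (b' : J' -> V) v :
  (forall j, span_mod b' (b j)) -> span_mod b v -> span_mod b' v.
Proof.
move=> sbb' [c Nc]; rewrite -(subrK (\sum_j c j *: b j) v).
by apply: span_modD; [exact: span_mod_sub | apply: span_mod_sum => j _; exact: span_modZ].
Qed.

Lemma free_mod_leq (J J' : finType) (b : J -> V) (b' : J' -> V) :
  free_mod b -> (forall j, span_mod b' (b j)) -> (#|J| <= #|J'|)%N.
Proof.
move=> freeb sbb'; pose c j := sval (cid (sbb' j)).
have cP j : N (b j - \sum_i c j i *: b' i) by rewrite /c; case: cid.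
pose M : 'M[F]_(#|J|, #|J'|) := \matrix_(i, k) c (enum_val i) (enum_val k).
rewrite leqNgt; apply/negP => ltJ.
have : kermx M != 0.
  rewrite -mxrank_eq0 mxrank_ker -lt0n subn_gt0.
  exact: leq_ltn_trans (rank_leq_col M) ltJ.
case/rowV0Pn=> u /sub_kermxP uM /rV0Pn[i0 ui0].
pose d j := u 0 (enum_rank j).
have : N (\sum_j d j *: b j).
  have -> : \sum_j d j *: b j = \sum_j d j *: (b j - \sum_i c j i *: b' i).
    under [RHS]eq_bigr do rewrite scalerBr scaler_sumr.
    rewrite sumrB exchange_big /= [X in _ - X]big1 ?subr0 // => k _.
    under eq_bigr do rewrite scalerA.
    rewrite -scaler_suml.
    have := congr1 (fun v : 'rV_#|J'| => v 0 (enum_rank k)) uM; rewrite !mxE.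
    rewrite (reindex (enum_rank : J -> 'I_#|J|)) /=; last first.
      by apply: onW_bij; exact: enum_rank_bij.
    under eq_bigr do rewrite mxE !enum_rankK.
    by move->; rewrite scale0r.
  case: subN => N0 ND NZ; elim/big_ind: _ => // j _; exact: NZ.
move/freeb/(_ (enum_val i0)); rewrite /d enum_valK => /eqP.
by rewrite (negPf ui0).
Qed.

Lemma basis_mod_exists (J : finType) (s : J -> V) :
  exists (h : nat) (b : 'I_h -> V),
    [/\ free_mod b, forall i, exists j, b i = s j & forall j, span_mod b (s j)].
Proof.
suff: exists A : {set J}, (forall c : J -> F, N (\sum_(j in A) c j *: s j) -> forall j, j \in A -> c j = 0)
   /\ forall j, exists c : J -> F, N (s j - \sum_(i in A) c i *: s i).
  case=> A [freeA spanA].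
  have reix (c : 'I_#|A| -> F) : exists c' : J -> F, (forall i, c' (enum_val i) = c i) /\
      \sum_(j in A) c' j *: s j = \sum_(i < #|A|) c i *: s (enum_val i).
    have ce : exists c' : J -> F, forall i, c' (enum_val i) = c i.
      exists (fun j => if pselect (j \in A) is left jA then c (enum_rank_in jA j) else 0).
      move=> i; case: pselect => [jA|[]]; last exact: enum_valP.
      by rewrite enum_valK_in.
    case: ce => c' c'P; exists c'; split=> //.
    rewrite big_enum_val /=; by apply: eq_bigr => i _; rewrite c'P.
  exists #|A|, (fun i => s (enum_val i)); split=> [c|i|j].
  - case: (reix c) => c' [c'P <-] /freeA c'0 i; rewrite -c'P.
    by apply: c'0; exact: enum_valP.
  - by exists (enum_val i).
  - case: (spanA j) => c Nc; exists (fun i => c (enum_val i)).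
    by move: Nc; rewrite big_enum_val.
pose Q (A : {set J}) := `[< forall c : J -> F, N (\sum_(j in A) c j *: s j) -> forall j, j \in A -> c j = 0 >].
have Q0 : Q set0 by apply/asboolP => c _ j; rewrite inE.
case: (arg_maxnP (fun A : {set J} => #|A|) Q0) => A /asboolP freeA maxA.
exists A; split=> // j.
case: (boolP (j \in A)) => jA.
  exists (fun i => (i == j)%:R); rewrite (bigD1 j) //= eqxx scale1r big1 ?addr0 ?subrr.
    by case: subN.
  by move=> i /andP[_ /negPf->]; rewrite scale0r.
have nQ : ~~ Q (j |: A).
  by apply/negP => /maxA; rewrite /= cardsU1 jA add1n ltnn.
have [c [Nc [k kjA ck]]] : exists c : J -> F, N (\sum_(i in j |: A) c i *: s i) /\ exists2 k, k \in j |: A & c k != 0.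
  apply: contrapT => no; apply: (negP nQ); apply/asboolP => c Nc k kjA; apply/eqP; apply: contrapT => /negP ck.
  by apply: no; exists c; split=> //; exists k.
rewrite big_setU1 //= in Nc.
have cj : c j != 0.
  apply: contraTneq ck => cj0; rewrite cj0 scale0r add0r in Nc.
  rewrite negbK; apply/eqP; move: kjA; rewrite !inE => /orP[/eqP->//|kA].
  exact: freeA Nc k kA.
exists (fun i => - (c j)^-1 * c i).
under eq_bigr do rewrite -scalerA.
case: subN => _ _ NZ.
rewrite -scaler_sumr scaleNr opprK.
have := NZ (c j)^-1 _ Nc; rewrite scalerDr scalerA mulVf // scale1r.
by [].
Qed.

End Independence.

(** * The projective Nullstellensatz *)

Section HomogeneousParts.
Variables (F : fieldType) (n : nat).
Implicit Types (p q : {mpoly F[n]}).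

Lemma mnm_split (m : 'X_{1..n}) d e : mdeg m = (d + e)%N ->
  exists m1 m2, [/\ m = (m1 + m2)%MM, mdeg m1 = d & mdeg m2 = e].
Proof.
elim: d m => [|d IHd] m; first by exists 0%MM, m; rewrite add0m mdeg0.
rewrite addSn => degm.
have [i mi] : exists i, m i != 0%N.
  apply/existsP; apply: contraPT degm; rewrite negb_exists => /forallP m0.
  rewrite mdegE big1 // => i _.
  by have := m0 i; rewrite negbK => /eqP.
have leUm : (U_(i) <= m)%MM by rewrite lep1mP.
have degm' : mdeg (m - U_(i))%MM = (d + e)%N.
  by apply/eqP; rewrite -(eqn_add2r 1) -{1}(mdeg1 i) -mdegD submK // degm addn1.
have [m1 [m2 [eqm dm1 dm2]]] := IHd _ degm'.
exists (m1 + U_(i))%MM, m2; split=> //; last by rewrite mdegD dm1 mdeg1 addn1.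
by rewrite -(submK leUm) eqm -!addmA [(m2 + _)%MM]addmC.
Qed.

(** Every monomial of degree [d + e] is a product of monomials of degrees [d]
    and [e]. *)
Lemma homog_subspace_ind (I : {mpoly F[n]} -> Prop) d e : is_subspace I ->
  (forall p q, p \is d.-homog -> q \is e.-homog -> I (p * q)) ->
  forall p, p \is (d + e).-homog -> I p.
Proof.
case=> I0 ID IZ Iprod p /dhomogP hp; rewrite (mpolyE p) big_seq.
elim/big_ind: _ => // m /hp degm; apply: IZ.
have [m1 [m2 [-> dm1 dm2]]] := mnm_split degm; rewrite mpolyXD.
by apply: Iprod; rewrite dhomogX; apply/eqP.
Qed.

Lemma pihomogMr d e p q : q \is e.-homog ->
  pihomog [measure of mdeg] d (p * q) =
  if (e <= d)%N then pihomog [measure of mdeg] (d - e) p * q else 0.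
Proof.
move=> hq; rewrite [in LHS](pihomog_partitionE (leqnn (msize p))).
rewrite mulr_suml raddf_sum /=.
have hpk k : pihomog mdeg k p * q \is (k + e).-homog.
  by apply: dhomogM => //; exact: pihomogP.
have pik k : pihomog mdeg d (pihomog mdeg k p * q) =
  if (k + e == d)%N then pihomog mdeg k p * q else 0.
  case: eqP => [ed|/eqP ned]; first by rewrite pihomog_dE // -ed.
  exact: pihomog_ne0 ned (hpk k).
under eq_bigr do rewrite pik.
case: leqP => [led|ltd]; last first.
  rewrite big1 // => k _; case: eqP => // ek.
  by move: ltd; rewrite -ek ltnNge leq_addl.
case: (ltnP (d - e) (msize p)) => [lts|les].
  rewrite (bigD1 (Ordinal lts)) //= subnK // eqxx big1 ?addr0 // => k nk.
  case: eqP => // ek; case/eqP: nk; apply: val_inj => /=.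
  by rewrite -ek addnK.
rewrite big1 => [|k _]; last first.
  case: eqP => // ek; have := ltn_ord k.
  by rewrite ltnNge (leq_trans les) // -ek addnK.
rewrite pihomogE big_seq_cond big1 ?mul0r // => m /andP[ms /eqP degm].
by have := msize_mdeg_lt ms; rewrite degm ltnNge les.
Qed.

Lemma homog_span_mod (N : {mpoly F[n]} -> Prop) d p : is_subspace N ->
  p \is d.-homog ->
  span_mod N (fun m : 'X_{1..n < d.+1} =>
    if mdeg m == d then 'X_[m] else 0) p.
Proof.
move=> subN /dhomogP hp; rewrite (mpolyE p) big_seq.
apply: span_mod_sum => // m ms; apply: span_modZ => //.
have degm : mdeg m = d by exact: hp.
have ltm : (mdeg m < d.+1)%N by rewrite degm.
have := span_mod_gen subN (fun m : 'X_{1..n < d.+1} =>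
    if mdeg m == d then 'X_[m] else 0) (BMultinom ltm).
by rewrite /= degm eqxx.
Qed.

Lemma ideal_subspace (I : {mpoly F[n]} -> Prop) : is_ideal I -> is_subspace I.
Proof. by case=> I0 ID IM; split=> // a u Iu; rewrite -mul_mpolyC; apply: IM. Qed.

End HomogeneousParts.

Section Nullstellensatz.
Variables (F : closedFieldType) (n : nat).
Implicit Types (I : {mpoly F[n]} -> Prop) (p q : {mpoly F[n]}).

Definition homog_ideal I : Prop :=
  is_ideal I /\ forall d p, I p -> I (pihomog mdeg d p).

Definition contains_degree I (d : nat) : Prop :=
  forall p, p \is d.-homog -> I p.

Lemma contains_degree_leq I d e : is_ideal I -> (d <= e)%N ->
  contains_degree I d -> contains_degree I e.
Proof.
move=> idI /subnK <- Id; apply: homog_subspace_ind; first exact: ideal_subspace.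
by move=> p q _ hq; case: (idI) => _ _; apply; apply: Id.
Qed.

Definition adjoin I (f : {mpoly F[n]}) (p : {mpoly F[n]}) : Prop :=
  exists a, I (p - a * f).

Lemma adjoin_homog_ideal I f e : homog_ideal I -> f \is e.-homog ->
  homog_ideal (adjoin I f).
Proof.
move=> [idI piI] hf; case: (idI) => I0 ID IM; split; first split.
- by exists 0; rewrite mul0r subr0.
- by move=> p q [a Ia] [b Ib]; exists (a + b); rewrite mulrDl opprD addrACA; apply: ID.
- by move=> p q [a Ia]; exists (p * a); rewrite -mulrA -mulrBr; apply: IM.
move=> d p [a /(piI d)]; rewrite raddfB /= (pihomogMr _ _ hf).
by case: ifP => _ Ip; [exists (pihomog mdeg (d - e) a) | exists 0; rewrite mul0r].
Qed.

Section Maximal.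
Variable I : {mpoly F[n]} -> Prop.
Hypothesis homI : homog_ideal I.
Hypothesis nI : forall d, ~ contains_degree I d.
Hypothesis maxI : forall J, homog_ideal J -> (forall d, ~ contains_degree J d) ->
  (forall p, I p -> J p) -> forall p, J p -> I p.

Let idI : is_ideal I. Proof. by case: homI. Qed.
Let sbI : is_subspace I. Proof. exact: ideal_subspace. Qed.

Lemma maximal_adjoin f e : f \is e.-homog -> ~ I f ->
  exists d, contains_degree (adjoin I f) d.
Proof.
move=> hf nIf; apply: contrapT => no; apply: nIf.
apply: (maxI (adjoin_homog_ideal homI hf)).
- by move=> d Id; apply: no; exists d.
- by move=> p Ip; exists 0; rewrite mul0r subr0.
- by exists 1; rewrite mul1r subrr; case: idI.
Qed.

(** If [f] and [g] were both outside [I], then [I + (f)] and [I + (g)] would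
    contain all forms of high degree, and hence so would [I + (f * g)]. *)
Lemma maximal_prime f g d e : f \is d.-homog -> g \is e.-homog ->
  I (f * g) -> I f \/ I g.
Proof.
move=> hf hg Ifg; apply: contrapT => no.
have [df If] := maximal_adjoin hf (fun h => no (or_introl h)).
have [dg Ig] := maximal_adjoin hg (fun h => no (or_intror h)).
apply: (nI (d := (df + dg)%N)); apply: homog_subspace_ind => // p q /If[a Ia] /Ig[b Ib].
have -> : p * q = q * (p - a * f) + (a * f) * (q - b * g) + (a * b) * (f * g) by ring.
by case: idI => _ ID IM; apply: (ID); [apply: (ID)|]; apply: (IM).
Qed.

(** Multiplication by [f] is bijective between high degrees modulo [I], so
    that the quotient [g / f] acts on a finite-dimensional space and has an
    eigenvalue [a]. An eigenvector is not in [I], hence [g - a *: f] is. *)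
Lemma maximal_linear f g : f \is 1.-homog -> g \is 1.-homog -> ~ I f ->
  exists a, I (g - a *: f).
Proof.
move=> hf hg nIf; have [d If] := maximal_adjoin hf nIf.
have [h [b [freeb bX spanb]]] := basis_mod_exists sbI
  (fun m : 'X_{1..n < d.+1} => if mdeg m == d then 'X_[F, m] else 0).
have hb i : b i \is d.-homog.
  by case: (bX i) => m ->; case: eqP => [em|_]; rewrite ?rpred0 // dhomogX; exact/eqP.
have spand p : p \is d.-homog -> span_mod I b p.
  by move=> hp; apply: span_mod_trans spanb (homog_span_mod sbI hp).
have mulg i : exists c : 'I_h -> F, I (g * b i - f * \sum_j c j *: b j).
  have hgb : g * b i \is (1 + d).-homog by exact: dhomogM.
  have [a Ia] := contains_degree_leq (adjoin_homog_ideal homI hf).1 (leq_addl 1 d) If hgb.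
  case: homI => _ /(_ (1 + d)%N _ Ia); rewrite raddfB /= pihomog_dE //.
  rewrite (pihomogMr _ _ hf) add1n ltnS leq0n subn1 /= => Ia'.
  have [c Ic] := spand _ (pihomogP [measure of mdeg] d a).
  exists c.
  case: (idI) => _ ID IM.
  have -> : g * b i - f * (\sum_j c j *: b j) =
     (g * b i - pihomog mdeg d a * f) + f * (pihomog mdeg d a - \sum_j c j *: b j) by ring.
  by apply: ID => //; apply: IM.
pose M : 'M[F]_h := \matrix_(i, j) sval (cid (mulg i)) j.
have MP i : I (g * b i - f * \sum_j M i j *: b j).
  rewrite (eq_bigr (fun j => sval (cid (mulg i)) j *: b j)) => [|j _]; last by rewrite mxE.
  by case: cid.
have h_gt0 : (0 < h)%N.
  rewrite lt0n; apply/eqP => h0; apply: (nI (d := d)) => p /spand[c].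
  by rewrite big1 ?subr0 // => i; have := ltn_ord i; rewrite [X in (_ < X)%N]h0.
have [a ra] : exists a, root (char_poly M) a.
  by apply/closed_rootP; rewrite size_char_poly; case: (h) h_gt0.
move: ra; rewrite -eigenvalue_root_char => /eigenvalueP[v vM v0].
exists a.
pose w := \sum_i v 0 i *: b i.
have hw : w \is d.-homog by apply: rpred_sum => i _; apply: dhomogZ.
have hga : g - a *: f \is 1.-homog by apply: rpredB => //; apply: dhomogZ.
have : I ((g - a *: f) * w).
  have -> : (g - a *: f) * w = \sum_i v 0 i *: (g * b i - f * \sum_j M i j *: b j).
    under [RHS]eq_bigr do rewrite scalerBr !scalerAr.
    rewrite sumrB -!mulr_sumr mulrBl; congr (_ * _ - _).
    rewrite -scalerAl scalerAr; congr (_ * _).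
    under [RHS]eq_bigr do rewrite scaler_sumr.
    rewrite exchange_big /= scaler_sumr; apply: eq_bigr => j _.
    under [RHS]eq_bigr do rewrite scalerA.
    rewrite -scaler_suml scalerA; congr (_ *: _).
    by have := congr1 (fun u : 'rV_h => u 0 j) vM; rewrite !mxE.
  by apply: ideal_sum => // i _; case: sbI => _ _; apply.
case/(maximal_prime hga hw) => // /freeb v_eq0.
by case/eqP: v0; apply/rowP => i; rewrite v_eq0 mxE.
Qed.

(** Modulo [I], every variable is a multiple [v i *: 'X_k] of the same one; the
    coefficients are the coordinates of the zero. *)
Lemma maximal_has_zero : exists2 v : 'I_n -> F, (exists i, v i != 0) &
  forall d p, p \is d.-homog -> I p -> p.@[v] = 0.
Proof.
case: (idI) => I0 ID IM.
have hX i : ('X_i : {mpoly F[n]}) \is 1.-homog by rewrite dhomogX; apply/eqP; exact: mdeg1.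
have [k nIk] : exists k, ~ I 'X_k.
  apply: contrapT => no; apply: (nI (d := 1)) => p hp.
  have : p \is (1 + 0).-homog by [].
  apply: (homog_subspace_ind sbI) => {hp}p q /dhomogP hp _.
  rewrite mulrC; apply: IM; rewrite (mpolyE p) big_seq; apply: ideal_sum => // m /hp.
  move/eqP; rewrite /= => /mdeg1P[i /eqP->]; case: sbI => _ _; apply.
  by apply: contrapT => nIi; apply: no; exists i.
have ex_v i := maximal_linear (hX k) (hX i) nIk.
pose v i := sval (cid (ex_v i)).
have vP i : I ('X_i - v i *: 'X_k) by rewrite /v; case: cid.
exists v; first exists k.
  apply/eqP => vk; apply: nIk.
  by have := vP k; rewrite vk scale0r subr0.
move=> d p hp Ip.
have congX m : I ('X_[m] - (\prod_i v i ^+ m i) *: 'X_k ^+ mdeg m).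
  elim: {m}(mdeg m) {-2}m (erefl (mdeg m)) => [|e IH] m.
    move/eqP; rewrite mdeg_eq0 => /eqP->; rewrite mpolyX0 mdeg0 expr0 big1 ?scale1r ?subrr //.
    by move=> i _; rewrite mnm0E expr0.
  rewrite -add1n => degm; have [m1 [m2 [-> dm1 dm2]]] := mnm_split degm.
  have /mdeg1P[i /eqP->] : mdeg m1 == 1%N by apply/eqP.
  have -> : \prod_j v j ^+ (U_(i) + m2)%MM j = v i * \prod_j v j ^+ m2 j.
    under eq_bigr do rewrite mnmDE exprD.
    rewrite big_split /=; congr (_ * _).
    rewrite (bigD1 i) //= mnm1E eqxx expr1 big1 ?mulr1 // => j /negPf ji.
    by rewrite mnm1E eq_sym ji.
  rewrite mpolyXD mdegD mdeg1 dm2 add1n exprS.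
  have -> : 'X_i * 'X_[m2] - (v i * (\prod_j v j ^+ m2 j)) *: ('X_k * 'X_k ^+ e) =
    'X_[m2] * ('X_i - v i *: 'X_k)
    + v i *: 'X_k * ('X_[m2] - (\prod_j v j ^+ m2 j) *: 'X_k ^+ e) :> {mpoly F[n]}.
    by rewrite -!mul_mpolyC rmorphM /=; ring.
  by apply: ID; apply: IM => //; rewrite -dm2; apply: IH.
have : I (p.@[v] *: 'X_k ^+ d).
  suff Ipv : I (p - p.@[v] *: 'X_k ^+ d).
    by rewrite -(subKr p (_ *: _)); apply: idealB.
  move: (hp) => /dhomogP hpd.
  rewrite mevalE {1}(mpolyE p) scaler_suml -sumrB big_seq.
  apply: ideal_sum => // m /hpd <-.
  by rewrite -scalerA -scalerBr; case: sbI => _ _; apply.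
move=> Ipv; apply/eqP; apply: contrapT => /negP pv.
have {Ipv} : I ('X_k ^+ d).
  rewrite -(scale1r ('X_k ^+ d)) -(mulVf pv) -scalerA.
  by case: sbI => _ _; apply.
elim: d {hp} => [|e IH].
  rewrite expr0 => I1; apply: (nI (d := 0)) => q _.
  by rewrite -(mulr1 q); apply: IM.
rewrite exprS => /(maximal_prime (hX k) (dhomogMn e (hX k))) [//|]; exact: IH.
Qed.

End Maximal.

(** If the ideal of the [q i] contained no full degree, it would lie in a
    homogeneous ideal that is maximal with this property, and such an ideal has
    a zero. *)
Theorem projective_nullstellensatz (k : nat) (q : 'I_k -> {mpoly F[n]}) (e : 'I_k -> nat) :
  (forall i, q i \is (e i).-homog) ->
  (forall v : 'I_n -> F, (forall i, (q i).@[v] = 0) -> forall j, v j = 0) ->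
  exists d0, forall d, (d0 <= d)%N -> forall p, p \is d.-homog ->
    exists2 a : 'I_k -> {mpoly F[n]}, forall i, a i \is (d - e i).-homog &
      p = \sum_i a i * q i.
Proof.
move=> hq nozero.
pose J p := exists a : 'I_k -> {mpoly F[n]}, p = \sum_i a i * q i.
have piJ d p : J p -> exists2 a : 'I_k -> {mpoly F[n]}, forall i, a i \is (d - e i).-homog &
    pihomog mdeg d p = \sum_i (if (e i <= d)%N then a i * q i else 0).
  case=> a ->; exists (fun i => pihomog mdeg (d - e i) (a i)).
    by move=> i; exact: pihomogP.
  by rewrite raddf_sum; apply: eq_bigr => i _ /=; rewrite (pihomogMr _ _ (hq i)).
have homJ : homog_ideal J.
  split; first split.
  - by exists (fun=> 0); rewrite big1 // => i _; rewrite mul0r.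
  - move=> _ _ [a ->] [b ->]; exists (fun i => a i + b i).
    by rewrite -big_split; apply: eq_bigr => i _; rewrite mulrDl.
  - move=> r _ [a ->]; exists (fun i => r * a i).
    by rewrite mulr_sumr; apply: eq_bigr => i _; rewrite mulrA.
  move=> d p /(piJ d)[a _ ->]; exists (fun i => if (e i <= d)%N then a i else 0).
  by apply: eq_bigr => i _; case: ifP; rewrite ?mul0r.
have [d0 Jd0] : exists d, contains_degree J d.
  apply: contrapT => no.
  pose P I := [/\ homog_ideal I, forall d, ~ contains_degree I d & forall p, J p -> I p].
  have [I [homI nI JI] maxI] : exists2 I, P I & forall I', P I' -> (forall p, I p -> I' p) -> forall p, I' p -> I p.
    apply: ideal_maximal; first by move=> I [[]].
    by exists J; split=> // d Jd; apply: no; exists d.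
  have [I' homI' nI' II'|v [i vi] vI] := maximal_has_zero homI nI.
    by apply: maxI => //; split=> // p /JI/II'.
  case/eqP: vi; apply: nozero => j; apply: (vI _ _ (hq j)); apply: JI.
  by exists (fun l => (l == j)%:R); rewrite (bigD1 j) //= eqxx mul1r big1 ?addr0 // => l /negPf->; rewrite mul0r.
exists (maxn d0 (\max_i e i)) => d; rewrite geq_max => /andP[led /bigmax_leqP lee] p hp.
have Jp : J p by exact: contains_degree_leq homJ.1 led Jd0 _ hp.
have [a ha] := piJ d p Jp; rewrite pihomog_dE // => ->; exists a => //.
by apply: eq_bigr => i _; rewrite lee.
Qed.

End Nullstellensatz.

(** * Systems of quadrics with fewer equations than unknowns *)

Lemma eq0_subspace (F : fieldType) (V : lmodType F) : is_subspace (fun u : V => u = 0).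
Proof. by split=> [|u v -> ->|a u ->]; rewrite ?addr0 ?scaler0. Qed.

(** If the [r] quadrics had no common zero, then by the Nullstellensatz every
    polynomial would be a combination of products of powers of the quadrics
    with finitely many monomials. In degree at most [M] there are
    O(M ^ r) such products, against at least (M / n) ^ n monomials. *)
Theorem quadrics_common_zero (F : closedFieldType) (n r : nat) (q : 'I_r -> {mpoly F[n]}) :
  (r < n)%N -> (forall i, q i \is 2.-homog) ->
  exists2 v : 'I_n -> F, (exists j, v j != 0) & forall i, (q i).@[v] = 0.
Proof.
move=> ltrn hq; apply: contrapT => no.
have [d0 gen] : exists d0, forall d, (d0 <= d)%N -> forall p : {mpoly F[n]}, p \is d.-homog ->
    exists2 a : 'I_r -> {mpoly F[n]}, forall i, a i \is (d - 2).-homog &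
      p = \sum_i a i * q i.
  apply: (projective_nullstellensatz hq) => v qv j; apply/eqP; apply: contrapT => /negP vj.
  by apply: no; exists v => //; exists j.
pose D := d0.+1.
have sub0 := @eq0_subspace F {mpoly F[n]}.
pose b M (x : {ffun 'I_r -> 'I_M.+1} * 'X_{1..n < D}) : {mpoly F[n]} :=
  (\prod_i q i ^+ x.1 i) * 'X_[x.2].
have spanb M d : forall (al : 'I_r -> nat) p, (d + \sum_i al i <= M)%N -> p \is d.-homog ->
    span_mod (fun u => u = 0) (b M) ((\prod_i q i ^+ al i) * p).
  elim/ltn_ind: d => d IH al p leM hp.
  case: (ltnP d D) => [ltd|led].
    have [c pE] := homog_span_mod sub0 hp; move/eqP: pE; rewrite subr_eq0 => /eqP ->.
    rewrite mulr_sumr; apply: (span_mod_sum sub0) => m _; rewrite -scalerAr.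
    apply: (span_modZ sub0); case: eqP => [em|_]; last first.
      by rewrite mulr0; apply: span_mod_sub.
    have ltm : (mdeg m < D)%N by rewrite em.
    have ltal i : (al i < M.+1)%N.
      rewrite ltnS (leq_trans _ leM) //; apply: leq_trans (leq_addl _ _).
      by rewrite (bigD1 i) //= leq_addr.
    have := span_mod_gen sub0 (b M) ([ffun i => Ordinal (ltal i)], BMultinom ltm).
    by rewrite /b /=; under eq_bigr do rewrite ffunE.
  have [a ha ->] := gen d (ltnW led) p hp.
  rewrite mulr_sumr; apply: (span_mod_sum sub0) => i _.
  have d_gt0 : (0 < d)%N by apply: leq_trans led.
  have -> : (\prod_j q j ^+ al j) * (a i * q i) =
      (\prod_j q j ^+ (al j + (j == i))) * a i.
    under [in RHS]eq_bigr do rewrite exprD.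
    rewrite big_split /= [X in _ = _ * X * _](bigD1 i) //= eqxx expr1.
    rewrite [X in _ = _ * (_ * X) * _]big1 ?mulr1; first by rewrite -mulrA [a i * _]mulrC.
    by move=> j /negPf->.
  apply: (IH (d - 2)%N) => //; first by rewrite ltn_subrL.
  have sum1 : (\sum_j nat_of_bool (j == i) = 1)%N.
    by rewrite (bigD1 i) //= eqxx big1 // => j /negPf->.
  rewrite big_split /= sum1.
  apply: leq_trans leM; rewrite addnA addn1 -addSn leq_add2r.
  by case: (d) d_gt0 => // -[|d'] _; rewrite ?subSS ?subn0.
pose c := #|{: 'X_{1..n < D}}|.
(* This makes (K + 1) ^ n larger than (n * (K + 1)) ^ r * c whenever r < n. *)
pose K := (n ^ r * c)%N.
pose s (g : {ffun 'I_n -> 'I_K.+1}) : {mpoly F[n]} := 'X_[ [multinom nat_of_ord (g i) | i < n] ].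
have frees : free_mod (fun u => u = 0) s.
  move=> co h g.
  have := congr1 (fun p : {mpoly F[n]} => p@_[multinom nat_of_ord (g i) | i < n]) h.
  rewrite mcoeff0 raddf_sum /= (bigD1 g) //= mcoeffZ mcoeffX eqxx mulr1.
  rewrite big1 ?addr0 // => g' ng; rewrite mcoeffZ mcoeffX.
  case: eqP => [/mnmP e|]; last by rewrite mulr0.
  case/eqP: ng; apply/ffunP => i; apply: val_inj.
  by have := e i; rewrite !mnmE.
have spans g : span_mod (fun u => u = 0) (b (n * K)%N) (s g).
  rewrite -(mul1r (s g)).
  have -> : 1 = \prod_i q i ^+ (fun=> 0%N) i by rewrite big1 // => i _; rewrite expr0.
  apply: (spanb _ (mdeg [multinom nat_of_ord (g i) | i < n])); last by rewrite dhomogX.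
  rewrite big1 // addn0 mdegE -[X in (_ <= X * _)%N]card_ord -sum_nat_const.
  by apply: leq_sum => i _; rewrite mnmE -ltnS.
have := free_mod_leq sub0 frees spans.
rewrite card_prod !card_ffun !card_ord -/c => le1.
have n_gt0 : (0 < n)%N by apply: leq_ltn_trans ltrn.
have : (K.+1 ^ r.+1 <= K.+1 ^ r * K)%N.
  apply: leq_trans (leq_trans _ _); first by apply: leq_pexp2l ltrn.
    exact: le1.
  rewrite [X in (_ <= _ * X)%N](_ : K = (n ^ r * c)%N) // mulnA leq_mul2r -expnMn; apply/orP; right.
  case: (r) => // r'; rewrite leq_exp2r // [X in (_ <= X)%N]mulnC mulnS.
  by rewrite -add1n leq_add2r.
by rewrite expnS mulnC leq_pmul2l ?expn_gt0 // ltnn.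
Qed.

(** * Zariski-closed subsets of a curve *)

Lemma homog_meval_scale (F : fieldType) n (p : {mpoly F[n]}) d (a : F) (v w : 'I_n -> F) :
  p \is d.-homog -> (forall i, w i = a * v i) -> p.@[w] = a ^+ d * p.@[v].
Proof.
move=> /dhomogP hp wE; rewrite !mevalE mulr_sumr !big_seq; apply: eq_bigr => m /hp <-.
rewrite mulrCA; congr (_ * _).
under eq_bigr do rewrite wE exprMn.
by rewrite big_split /= prodrXr -mdegE.
Qed.

Section ProjectiveSpace.
Variables (F : fieldType) (N : nat).
Implicit Types x y : proj_space F N.

Lemma rep_neq0 x : rep x != 0.
Proof.
by case: x => U dU; rewrite /rep vpick0 /= -dimv_eq0 (eqP dU).
Qed.

Lemma rep_coord x : exists k, rep x 0 k != 0.
Proof. by have /rV0Pn := rep_neq0 x. Qed.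

Lemma proj_line x : val x = <[rep x]>%VS.
Proof.
apply/eqP; rewrite eq_sym eqEdim dim_vline rep_neq0 (eqP (valP x)) andbT.
by rewrite -memvE memv_pick.
Qed.

Lemma proj_eq x y a : rep y = a *: rep x -> x = y.
Proof.
move=> yx; apply/val_inj/esym/eqP; rewrite eqEdim (eqP (valP x)) (eqP (valP y)) andbT.
by rewrite !proj_line -memvE yx memvZ // memv_line.
Qed.

Lemma proj_of_vec (v : 'rV[F]_N.+1) : v != 0 ->
  exists x, exists2 a, a != 0 & rep x = a *: v.
Proof.
move=> v0; have dv : \dim <[v]> == 1%N by rewrite dim_vline v0.
pose x : proj_space F N := exist (fun U : {vspace _} => \dim U == 1%N) _ dv.
exists x; have : rep x \in <[v]>%VS by exact: memv_pick.
case/vlineP => a ra; exists a => //.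
by apply: contraTneq (rep_neq0 x) => a0; rewrite ra a0 scale0r negbK.
Qed.

End ProjectiveSpace.

Section CurveTopology.
Variables (F : closedFieldType) (C : curve F).
Notation N := (ambient_dim C).
Implicit Types (x y : C) (p q : {mpoly F[N.+1]}).

Lemma evE p x : ev p x = p.@[coords x 0]. Proof. by []. Qed.

Lemma ev_equation p x : p \in equations C -> ev p x = 0.
Proof.
by move=> pE; have /allP/(_ p pE)/eqP := valP (x : zero_locus (equations C)).
Qed.

Lemma evD p q x : ev (p + q) x = ev p x + ev q x. Proof. exact: mevalD. Qed.
Lemma evB p q x : ev (p - q) x = ev p x - ev q x. Proof. exact: mevalB. Qed.
Lemma evM p q x : ev (p * q) x = ev p x * ev q x. Proof. exact: mevalM. Qed.
Lemma evZ a p x : ev (a *: p) x = a * ev p x. Proof. exact: mevalZ. Qed.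
Lemma ev1 x : ev 1 x = 1. Proof. exact: meval1. Qed.
Lemma ev0 x : ev 0 x = 0. Proof. exact: meval0. Qed.

Definition evr := (evB, evD, evM, evZ, ev1, ev0).

Definition clsd (Z : C -> Prop) : Prop := @zclosed F _ (equations C) Z.

Lemma clsd_opn (Z : C -> Prop) : clsd Z -> opn (fun x => ~ Z x).
Proof.
case=> T formT ZT; exists T => // x; rewrite -ZT.
by split; [exact: contrapT | move=> Zx; apply].
Qed.

Lemma clsd_form p d : p \is d.-homog -> clsd (fun x => ev p x = 0).
Proof.
move=> hp; exists (fun f => f = p) => [f ->|x]; first by exists d.
by split=> [? f ->//|]; apply.
Qed.

Lemma clsdI (A B : C -> Prop) : clsd A -> clsd B -> clsd (fun x => A x /\ B x).
Proof.
case=> S formS AS [T formT BT]; exists (fun f => S f \/ T f).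
  by move=> f [/formS|/formT].
move=> x; rewrite AS BT; split=> [[hS hT] f [/hS|/hT]//|h].
by split=> f hf; apply: h; [left | right].
Qed.

Lemma clsdU (A B : C -> Prop) : clsd A -> clsd B -> clsd (fun x => A x \/ B x).
Proof.
case=> S formS AS [T formT BT].
exists (fun h => exists f g, [/\ S f, T g & h = f * g]).
  move=> h [f [g [/formS[d hf] /formT[e hg] ->]]].
  by exists (d + e)%N; apply: dhomogM.
move=> x; rewrite AS BT; split=> [[h|h] _ [f [g [Sf Tg ->]]]|h].
- by rewrite [evalp _ _]evM [ev f x]h // mul0r.
- by rewrite [evalp _ _]evM [ev g x]h // mulr0.
- apply: contrapT => /not_orP[nS nT].
  apply: nS => f Sf; apply/eqP; apply: contrapT => /negP fx.
  apply: nT => g Tg; apply/eqP; apply: contrapT => /negP gx.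
  have : ev (f * g) x = 0 by apply: h; exists f, g.
  by rewrite evM => /eqP; rewrite mulf_eq0 (negPf fx) (negPf gx).
Qed.

Lemma opnI (U W : C -> Prop) : opn U -> opn W -> opn (fun x => U x /\ W x).
Proof.
move=> oU oW; case: (clsdU oU oW) => T formT UW; exists T => // x.
exact: iff_trans (not_andP _ _) (UW x).
Qed.

Lemma opn_true : opn (fun _ : C => True).
Proof.
exists (fun f => f = 1) => [f ->|x]; first by exists 0%N; rewrite dhomog1.
split=> [[]//|/(_ 1 erefl)]; rewrite [evalp _ _]ev1 => /eqP.
by rewrite oner_eq0.
Qed.

Lemma opn_form p d : p \is d.-homog -> opn (fun x => ev p x <> 0).
Proof. by move=> hp; apply: clsd_opn; apply: clsd_form hp. Qed.

Lemma opn_forall (n : nat) (U : 'I_n -> C -> Prop) :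
  (forall i, opn (U i)) -> opn (fun x => forall i, U i x).
Proof.
elim: n U => [|n IH] U oU.
  have : opn (fun _ : C => True) := opn_true.
  by congr opn; apply/funext => x; apply/propext; split=> // _ [].
have := opnI (oU ord0) (IH _ (fun i => oU (lift ord0 i))).
congr opn; apply/funext => x; apply/propext; split=> [[U0 US] i|h].
  by case: (unliftP ord0 i) => [j|] ->.
by split=> [|i]; apply: h.
Qed.

Lemma opn_meet (U W : C -> Prop) x y : opn U -> opn W -> U x -> W y ->
  exists z, U z /\ W z.
Proof.
move=> oU oW Ux Wy; apply: contrapT => no.
have [_ /(_ _ _ oU oW)[]] := curve_irreducible C.
- by move=> z _; apply: contrapT => /not_orP[/contrapT Uz /contrapT Wz]; apply: no; exists z.
- by move=> /(_ x I); apply.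
- by move=> /(_ y I); apply.
Qed.

Lemma opn_form_vanish (U : C -> Prop) x p d : p \is d.-homog -> opn U -> U x ->
  (forall y, U y -> ev p y = 0) -> forall y, ev p y = 0.
Proof.
move=> hp oU Ux pU y; apply: contrapT => py.
have [z [Uz pz]] := opn_meet oU (opn_form hp) Ux py.
by apply: pz; apply: pU.
Qed.

Lemma form_domain p q d e : p \is d.-homog -> q \is e.-homog ->
  (forall x, ev (p * q) x = 0) -> (forall x, ev p x = 0) \/ (forall x, ev q x = 0).
Proof.
move=> hp hq pq0; apply: contrapT => /not_orP[/existsNP[x px] /existsNP[y qy]].
have [z [pz qz]] := opn_meet (opn_form hp) (opn_form hq) px qy.
by have /eqP := pq0 z; rewrite evM mulf_eq0 => /orP[] /eqP.
Qed.

Lemma clsd_point x : clsd (fun y => y = x).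
Proof.
exists (fun f => f \is 1.-homog /\ ev f x = 0) => [f [hf _]|y]; first by exists 1%N.
split=> [-> f []//|h].
have [k xk] := rep_coord (val x).
apply/esym/val_inj; apply: (@proj_eq _ _ _ _ (coords y 0 k / coords x 0 k)).
apply/rowP => j; rewrite mxE.
pose f : {mpoly F[N.+1]} := coords x 0 k *: 'X_j - coords x 0 j *: 'X_k.
have hX i : ('X_i : {mpoly F[N.+1]}) \is 1.-homog by rewrite dhomogX; apply/eqP; exact: mdeg1.
have : ev f y = 0.
  apply: h; split; first by apply: rpredB; apply: dhomogZ.
  by rewrite /f !evr !evE !mevalXU mulrC subrr.
rewrite /f !evr !evE !mevalXU => /eqP; rewrite subr_eq0 => /eqP e.
by apply: (mulfI xk); rewrite [LHS]e mulrA mulrCA mulfV // mulr1 mulrC.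
Qed.

Definition finite_set (Z : C -> Prop) : Prop := exists s : seq C, forall x, Z x -> x \in s.

(** A minimal infinite closed subset is irreducible, since one of the pieces
    of any closed decomposition is infinite; if it were not all of the curve, it
    would be the middle of a chain of length two starting at a point. *)
Lemma clsd_finite (Z : C -> Prop) y : clsd Z -> ~ Z y -> finite_set Z.
Proof.
move=> cZ nZy; apply: contrapT => infZ.
pose J (Z : C -> Prop) p := forall x, Z x -> ev p x = 0.
(* Closed sets are compared through their vanishing ideals: a maximal ideal
   gives a minimal closed set. *)
pose P I := exists Z, [/\ clsd Z, ~ finite_set Z, exists y, ~ Z y & I = J Z].
have [] := @ideal_maximal _ _ P.
- move=> I [Z' [_ _ _ ->]]; split=> [x _|p q hp hq x Zx|p q hq x Zx]; rewrite !evr //.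
    by rewrite hp // hq // addr0.
  by rewrite hq // mulr0.
- by exists (J Z), Z; split=> //; exists y.
move=> _ [Y [cY infY [z nYz] ->]] maxY.
have minY A : clsd A -> ~ finite_set (fun x => Y x /\ A x) -> forall x, Y x -> A x.
  move=> cA infA; have cYA := clsdI cY cA.
  have sub : forall p, J (fun x => Y x /\ A x) p -> J Y p.
    apply: maxY; first by exists (fun x => Y x /\ A x); split=> //; exists z => -[].
    by move=> p h x [/h].
  case: cYA => T formT YAT x Yx.
  suff: Y x /\ A x by case.
  by apply/YAT => f Tf; apply: (sub f) => // w /YAT; apply.
have irrY : @zirreducible F _ (equations C) Y.
  split; first by apply: contrapT => no; apply: infY; exists [::] => x Yx; case: no; exists x.
  move=> A B cA cB YAB.
  case: (pselect (finite_set (fun x => Y x /\ A x))) => [[s sA]|]; last by left; apply: minY.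
  case: (pselect (finite_set (fun x => Y x /\ B x))) => [[t tB]|]; last by right; apply: minY.
  case: infY; exists (s ++ t) => x Yx; rewrite mem_cat.
  by case: (YAB x Yx) => h; [rewrite sA | rewrite tB ?orbT].
have [[w Yw] _] := irrY.
have [_] := curve_dim1 C; apply.
exists (fun i => if i is 0%N then fun x => x = w else if i is 1%N then Y else fun=> True).
split=> [[|[|i]] _ /=|[|[|i]] //= _].
- split; first exact: clsd_point.
  split; first by exists w.
  move=> A B _ _ /(_ w erefl)[]; [left | right] => x -> //.
- by [].
- split; last exact: curve_irreducible.
  exists (fun f => f = 0) => [f ->|x]; first by exists 0%N; rewrite rpred0.
  by split=> // _ f ->; exact: ev0.
- split=> [x -> //|]; apply: contrapT => no; apply: infY; exists [:: w] => x Yx.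
  by rewrite inE; apply/eqP; apply: contrapT => xw; apply: no; exists x.
- by split=> //; exists z.
Qed.

End CurveTopology.

(** * The homogeneous coordinate ring of a curve *)

Section CoordinateRing.
Variables (F : closedFieldType) (C : curve F).
Notation N := (ambient_dim C).
Implicit Types (x y : C) (p q : {mpoly F[N.+1]}).

Lemma homogX1 i : ('X_i : {mpoly F[N.+1]}) \is 1.-homog.
Proof. by rewrite dhomogX; apply/eqP; exact: mdeg1. Qed.

Lemma point_of_vec (v : 'I_N.+1 -> F) : (exists j, v j != 0) ->
  (forall p, p \in equations C -> p.@[v] = 0) ->
  exists x : C, exists2 a, a != 0 & forall j, coords x 0 j = a * v j.
Proof.
move=> [j vj] vE.
have [|z [a a0 rz]] := @proj_of_vec _ _ (\row_j v j).
  by apply/rV0Pn; exists j; rewrite mxE.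
have zE k : rep z 0 k = a * v k by rewrite rz !mxE.
have zC : all (fun f => evalp f z == 0) (equations C).
  apply/allP => p pE; have [d hp] := equations_form pE.
  by rewrite /evalp (homog_meval_scale hp zE) vE // mulr0.
by exists (exist _ z zC : zero_locus (equations C)), a.
Qed.

(** The form [\sum_j c ^+ j *: 'X_j] vanishes at a given point for finitely
    many [c] only. *)
Lemma linear_form_avoiding (s : seq C) :
  exists2 p, p \is 1.-homog & forall x, x \in s -> ev p x <> 0.
Proof.
pose P x := \poly_(j < N.+1) coords x 0 (inord j).
have P0 x : P x != 0.
  have [k xk] := rep_coord (val x); apply: contraNneq xk => Px0.
  by have := coef_poly N.+1 (fun j => coords x 0 (inord j)) k; rewrite -/(P x) Px0 coef0 ltn_ord inord_val => <-.
have prod0 : \prod_(x <- s) P x != 0 by rewrite prodf_seq_neq0; apply/allP => x _; exact: P0.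
have [c nrc] := closed_nonrootP _ prod0.
exists (\sum_(j < N.+1) c ^+ j *: 'X_j).
  by apply: rpred_sum => j _; apply: dhomogZ; exact: homogX1.
move=> x xs.
have -> : ev (\sum_(j < N.+1) c ^+ j *: 'X_j) x = (P x).[c].
  rewrite horner_poly evE raddf_sum /=; apply: eq_bigr => j _.
  by rewrite mevalZ mevalXU inord_val mulrC.
apply/eqP; move: nrc; rewrite /root horner_prod; apply: contraNneq => Px0.
by rewrite (big_rem x) //= Px0 mul0r.
Qed.

Lemma curve_nonempty : exists x : C, True.
Proof. by have [[x _] _] := curve_irreducible C; exists x. Qed.

(** Two linear forms without common zero on the curve: the second avoids the
    finitely many zeros of the first. By the Nullstellensatz, every form of high
    degree is a combination of them on the curve. *)
Lemma coordinate_ring_generated : exists l m d0,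
  [/\ l \is 1.-homog, m \is 1.-homog & forall d p, (d0 <= d)%N -> p \is d.-homog ->
    exists a b, [/\ a \is (d - 1).-homog, b \is (d - 1).-homog &
      forall x, ev p x = ev (a * l + b * m) x]].
Proof.
have [x0 _] := curve_nonempty.
have [k xk] := rep_coord (val x0).
have [s sP] : finite_set (fun x => ev 'X_k x = 0).
  apply: (clsd_finite (y := x0)); first exact: clsd_form (homogX1 k).
  by rewrite evE mevalXU; apply/eqP.
have [m hm mP] := linear_form_avoiding s.
pose L := 'X_k :: m :: equations C.
have hL i : exists d, L`_i \is d.-homog.
  case: i => [|[|i]] /=; [by exists 1%N; exact: homogX1 | by exists 1%N |].
  case: (ltnP i (size (equations C))) => [lti|gei].
    by apply: equations_form; apply: mem_nth.
  by exists 0%N; rewrite nth_default // rpred0.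
pose e i := if (i < 2)%N then 1%N else sval (cid (hL i)).
have he i : L`_i \is (e i).-homog.
  rewrite /e; case: i => [|[|i]] /=; [exact: homogX1 | by [] | by case: cid].
have [|d0 gen] := @projective_nullstellensatz _ _ (size L) (fun i => L`_i) (fun i => e i) (fun i => he i).
  move=> v vL j; apply/eqP; apply: contrapT => /negP vj.
  have vE p : p \in equations C -> p.@[v] = 0.
    move=> pE; have pL : p \in L by rewrite !inE pE !orbT.
    have lti : (index p L < size L)%N by rewrite index_mem.
    by have := vL (Ordinal lti); rewrite nth_index.
  have [x [a a0 xE]] := point_of_vec (ex_intro _ j vj) vE.
  (* A common zero of all these forms would be a zero of 'X_k, where m is nonzero. *)
  apply: (mP x); last first.
    by rewrite evE (homog_meval_scale hm xE) (vL (@Ordinal (size L) 1 isT)) mulr0.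
  apply: sP; rewrite evE (homog_meval_scale (homogX1 k) xE).
  by rewrite (vL (@Ordinal (size L) 0 isT)) mulr0.
exists 'X_k, m, d0; split=> // [|d p led hp]; first exact: homogX1.
have [a ha pE] := gen d led p hp.
exists (a ord0), (a (lift ord0 ord0)); split; [exact: (ha ord0) | exact: (ha (lift ord0 ord0)) |].
move=> x; rewrite pE !big_ord_recl /= addrA evD [X in _ + X]evE raddf_sum /= big1 ?addr0 //.
by move=> i _; rewrite mevalM -!evE (@ev_equation _ _ _`_i) ?mulr0 // mem_nth.
Qed.

Lemma span_mod_mul (I : {mpoly F[N.+1]} -> Prop) (J J' : finType)
    (b : J -> {mpoly F[N.+1]}) (b' : J' -> {mpoly F[N.+1]}) f p : is_ideal I ->
  (forall j, span_mod I b' (f * b j)) -> span_mod I b p -> span_mod I b' (f * p).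
Proof.
move=> idI fb [c Nc]; have sbI := ideal_subspace idI.
rewrite -(subrK (\sum_j c j *: b j) p) mulrDr mulr_sumr; apply: (span_modD sbI).
  by apply: span_mod_sub; case: idI => _ _; apply.
by apply: (span_mod_sum sbI) => j _; rewrite -scalerAr; apply: (span_modZ sbI).
Qed.

(** Forms of degree [d0 + k] are combinations of the [k + 1] products
    [l ^+ i * m ^+ (k - i)], with coefficients of degree [d0]. *)
Lemma hilbert_linear (I : {mpoly F[N.+1]} -> Prop) : is_ideal I ->
  (forall d p, p \is d.-homog -> (forall x, ev p x = 0) -> I p) ->
  exists A B, forall d h (b : 'I_h -> {mpoly F[N.+1]}),
    (forall i, b i \is d.-homog) -> free_mod I b -> (h <= A * d + B)%N.
Proof.
move=> idI I0; have sbI := ideal_subspace idI.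
have [l [m [d0 [hl hm gen]]]] := coordinate_ring_generated.
pose c d := #|{: 'X_{1..N.+1 < d.+1}}|.
exists (c d0), (\sum_(d < d0.+1) c d)%N => d h b hb freeb.
have c_le (i : 'I_d0.+1) : (c i <= \sum_(d < d0.+1) c d)%N.
  by rewrite (bigD1 i) //= leq_addr.
case: (ltnP d d0) => [ltd|led].
  apply: leq_trans (leq_addl _ _); apply: leq_trans (c_le (Ordinal (ltnW ltd : (d < d0.+1)%N))).
  rewrite -[X in (X <= _)%N]card_ord; apply: (free_mod_leq sbI freeb) => i.
  exact: (homog_span_mod sbI (hb i)).
pose mon k (x : 'I_k.+1 * 'X_{1..N.+1 < d0.+1}) : {mpoly F[N.+1]} :=
  l ^+ x.1 * m ^+ (k - x.1) * (if mdeg x.2 == d0 then 'X_[x.2] else 0).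
have spank k p : p \is (d0 + k).-homog -> span_mod I (mon k) p.
  elim: k p => [|k IH] p hp.
    rewrite addn0 in hp; apply: (span_mod_trans sbI) (homog_span_mod sbI hp) => be.
    have := span_mod_gen sbI (mon 0%N) (ord0, be).
    by rewrite /mon /= !expr0 !mul1r.
  have [|a [a' [ha ha' pE]]] := gen (d0 + k.+1)%N p _ hp; first exact: leq_addr.
  rewrite addnS subn1 /= in ha ha'.
  rewrite -(subrK (a * l + a' * m) p); apply: (span_modD sbI).
    apply: span_mod_sub; apply: (I0 (d0 + k.+1)%N) => [|x]; last by rewrite evB pE subrr.
    apply: rpredB => //; rewrite addnS.
    by apply: rpredD; [have := dhomogM ha hl | have := dhomogM ha' hm]; rewrite addn1.
  rewrite [a * _]mulrC [a' * _]mulrC.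
  apply: (span_modD sbI); apply: (span_mod_mul idI) (IH _ _) => // -[i be].
    have := span_mod_gen sbI (mon k.+1) (lift ord0 i, be).
    by rewrite /mon /= /bump leq0n add1n subSS exprS -!mulrA.
  have := span_mod_gen sbI (mon k.+1) (widen_ord (leqnSn _) i, be).
  by rewrite /mon /= (subSn (leq_ord i)) exprS !mulrA [m * l ^+ i]mulrC.
rewrite -(subnKC led) in hb.
have := free_mod_leq sbI freeb (fun i => spank _ _ (hb i)).
rewrite card_ord card_prod card_ord -/(c d0) => /leq_trans; apply.
rewrite mulnC mulnS addnC; apply: leq_add; last exact: (c_le ord_max).
by rewrite leq_mul2l leq_subr orbT.
Qed.

End CoordinateRing.

(** * The function field *)

Lemma fraction_num_den (D : idomainType) (a : {fraction D}) :
  exists n d : D, d != 0 /\ a = FracField.tofrac n / FracField.tofrac d.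
Proof.
elim/quotW: a => x; exists (frac x).1, (frac x).2; have d0 := denom_ratioP x.
split=> //; apply: (mulIf (x := FracField.tofrac (frac x).2)); first by rewrite tofrac_eq0.
rewrite divfK ?tofrac_eq0 //; unlock FracField.tofrac; rewrite -[LHS]FracField.pi_mul.
apply/eqmodP; rewrite /= FracField.equivfE /FracField.mulf.
by rewrite !numden_Ratio ?(oner_eq0, mulf_neq0) // !mulr1 mulrC.
Qed.

Section PrimeQuotient.
Local Open Scope quotient_scope.
Variables (R : comNzRingType) (I : R -> Prop).
Hypotheses (I0 : I 0) (I1 : ~ I 1).
Hypothesis Ilin : forall a u v, I u -> I v -> I (a * u + v).
Hypothesis Iprime : forall u v, I (u * v) -> I u \/ I v.

Let S : {pred R} := fun p => `[< I p >].

Let S_idealr : idealr_closed S.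
Proof.
split; [exact/asboolP | by apply/asboolP |].
by move=> a u v /asboolP Iu /asboolP Iv; apply/asboolP; exact: Ilin.
Qed.

Let S_prime : prime_idealr_closed S.
Proof.
move=> u v /asboolP/Iprime[Iu|Iv]; apply/orP; [left | right]; exact/asboolP.
Qed.

HB.instance Definition _ := isIdealr.Build R S S_idealr.
HB.instance Definition _ := isPrimeIdealrClosed.Build R S S_prime.

Notation Q := {ideal_quot S}.

Let q_unit : {pred Q} := fun x => `[< exists y, y * x = 1 >].
Let q_inv (x : Q) : Q :=
  if pselect (exists y, y * x = 1) is left ex then sval (cid ex) else x.

Let q_mulVx : {in q_unit, left_inverse 1 q_inv *%R}.
Proof.
by move=> x /asboolP ex; rewrite /q_inv; case: pselect => // ?; case: cid.
Qed.

Let q_unitP (x y : Q) : y * x = 1 -> q_unit x.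
Proof. by move=> yx; apply/asboolP; exists y. Qed.

Let q_inv_out : {in [predC q_unit], q_inv =1 id}.
Proof.
move=> x; rewrite inE => /negP nu; rewrite /q_inv; case: pselect => // ex.
by case: nu; apply/asboolP.
Qed.

HB.instance Definition _ := GRing.ComNzRing_hasMulInverse.Build Q q_mulVx q_unitP q_inv_out.
HB.instance Definition _ := GRing.ComUnitRing_isIntegral.Build Q (@Quotient.rquot_IdomainAxiom R S).

Lemma prime_quotient_fraction : exists (K : fieldType) (phi : {rmorphism R -> K}),
  (forall p, phi p = 0 <-> I p) /\
  forall a, exists p q, phi q <> 0 /\ a = phi p / phi q.
Proof.
pose phi : {rmorphism R -> {fraction Q}} := (@FracField.tofrac Q) \o (\pi_Q : R -> Q).
exists {fraction Q}, phi; split=> [p|a].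
  have -> : phi p = FracField.tofrac (\pi_Q p) by [].
  split=> [/eqP|Ip]; first rewrite tofrac_eq0.
    rewrite -[0](rmorph0 (\pi_Q : {rmorphism R -> Q})) -Quotient.idealrBE subr0.
    by move/asboolP.
  apply/eqP; rewrite tofrac_eq0 -[0](rmorph0 (\pi_Q : {rmorphism R -> Q})).
  by rewrite -Quotient.idealrBE subr0; apply/asboolP.
have [n [d [d0 ->]]] := fraction_num_den a.
exists (repr n), (repr d).
have phiE (x : Q) : phi (repr x) = FracField.tofrac x by rewrite /phi /= reprK.
by rewrite !phiE; split=> //; apply/eqP; rewrite tofrac_eq0.
Qed.
End PrimeQuotient.

Section FunctionField.
Variables (F : closedFieldType) (C : curve F).
Notation N := (ambient_dim C).
Implicit Types (x y : C) (p q : {mpoly F[N.+1]}).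

(** The field of rational functions, as a field [K] with a ring morphism [phi]
    evaluating polynomials at the coordinate functions (for some choice of
    homogeneous coordinates of the generic point). *)
Definition is_function_field (K : fieldType) (phi : {rmorphism {mpoly F[N.+1]} -> K}) : Prop :=
  (forall d p, p \is d.-homog -> (phi p = 0 <-> forall x, ev p x = 0)) /\
  forall a, exists d p q, [/\ p \is d.-homog, q \is d.-homog, phi q <> 0 & a = phi p / phi q].

(** Fraction field of the coordinate ring of the affine chart [X_k <> 0]. *)
Lemma function_field_exists : exists (K : fieldType)
  (phi : {rmorphism {mpoly F[N.+1]} -> K}), is_function_field phi.
Proof.
have [x0 _] := curve_nonempty C.
have [k xk] := rep_coord (val x0).
pose U x := ev 'X_k x <> 0.
have oU : opn U := opn_form (homogX1 k).
have Ux0 : U x0 by rewrite /U evE mevalXU; apply/eqP.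
pose aff p x := p.@[fun j => coords x 0 j / coords x 0 k].
have UE x : U x -> coords x 0 k != 0 by rewrite /U evE mevalXU => /eqP.
have homE d p x : p \is d.-homog -> U x -> ev p x = coords x 0 k ^+ d * aff p x.
  move=> hp /UE xk0; apply: homog_meval_scale hp _ => i.
  by rewrite mulrC divfK.
have homogenize p e : (msize p <= e)%N -> exists2 P, P \is e.-homog &
    forall x, U x -> ev P x = coords x 0 k ^+ e * aff p x.
  move=> le; exists (\sum_(d < msize p) 'X_k ^+ (e - d) * pihomog mdeg d p).
    apply: rpred_sum => d _; have led : (d <= e)%N by exact: leq_trans (ltnW (ltn_ord d)) le.
    have := dhomogM (dhomogMn (e - d) (homogX1 k)) (pihomogP [measure of mdeg] d p).
    by rewrite mul1n subnK.
  move=> x Ux.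
  have -> : aff p x = \sum_(d < msize p) aff (pihomog mdeg d p) x.
    by rewrite /aff {1}(pihomog_partitionE (leqnn (msize p))) raddf_sum.
  rewrite evE raddf_sum mulr_sumr.
  apply: eq_bigr => d _; have led : (d <= e)%N by exact: leq_trans (ltnW (ltn_ord d)) le.
  rewrite /= -evE evM (homE d (pihomog mdeg d p)) //; last exact: pihomogP.
  by rewrite mulrA evE rmorphXn /= mevalXU -exprD subnK.
pose I p := forall x, U x -> aff p x = 0.
have Ihom d p : p \is d.-homog -> (I p <-> forall x, ev p x = 0).
  move=> hp; split=> [Ip|p0 x Ux].
    by apply: (opn_form_vanish hp oU Ux0) => x Ux; rewrite (homE d) // Ip // mulr0.
  have /eqP := p0 x; rewrite (homE d) // mulf_eq0 expf_eq0 (negPf (UE x Ux)) andbF.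
  by move/eqP.
have [||a u v Iu Iv x Ux|u v Iuv|K [phi [phi0 phiF]]] := @prime_quotient_fraction _ I.
- by move=> x _; rewrite /aff meval0.
- by move=> /(_ x0 Ux0) /eqP; rewrite /aff meval1 oner_eq0.
- by rewrite /aff mevalD mevalM [u.@[_]]Iu // [v.@[_]]Iv // mulr0 addr0.
- have [P hP PE] := homogenize u _ (leqnn _); have [Q hQ QE] := homogenize v _ (leqnn _).
  have PQ0 : forall x, ev (P * Q) x = 0.
    apply: (opn_form_vanish (dhomogM hP hQ) oU Ux0) => x Ux.
    have affM : aff (u * v) x = aff u x * aff v x by rewrite /aff mevalM.
    by rewrite evM PE // QE // mulrACA -affM Iuv // mulr0.
  have zero e p P' : (forall x, U x -> ev P' x = coords x 0 k ^+ e * aff p x) ->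
      (forall x, ev P' x = 0) -> I p.
    move=> P'E P'0 x Ux; have /eqP := P'0 x.
    by rewrite P'E // mulf_eq0 expf_eq0 (negPf (UE x Ux)) andbF => /eqP.
  by case: (form_domain hP hQ PQ0) => [/(zero _ _ _ PE)|/(zero _ _ _ QE)]; [left | right].
exists K, phi; split=> [d p hp|a]; first exact: iff_trans (phi0 p) (Ihom d p hp).
have [p [q [q0 ->]]] := phiF a.
pose e := maxn (msize p) (msize q).
have [P hP PE] := homogenize p e (leq_maxl _ _).
have [Q hQ QE] := homogenize q e (leq_maxr _ _).
have phiQ0 : phi Q <> 0.
  move=> Q0; apply: q0; apply/phi0 => x Ux; have /(Ihom _ _ hQ) := (phi0 Q).1 Q0.
  by move=> /(_ x)/eqP; rewrite QE // mulf_eq0 expf_eq0 (negPf (UE x Ux)) andbF => /eqP.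
exists e, P, Q; split=> //.
apply/eqP; rewrite eqr_div; [|exact/eqP|exact/eqP].
rewrite -subr_eq0 -!rmorphM -rmorphB; apply/eqP/phi0 => x Ux.
rewrite /aff mevalB !mevalM -!/(aff _ _).
have PE' := homE _ _ _ hP Ux; have QE' := homE _ _ _ hQ Ux.
rewrite PE // in PE'; rewrite QE // in QE'.
have xe0 := expf_neq0 e (UE x Ux).
by rewrite -(mulfI xe0 PE') -(mulfI xe0 QE') mulrC subrr.
Qed.

End FunctionField.

(** * Tsen's theorem *)

Section Tsen.
Variables (F : closedFieldType) (C : curve F).
Notation N := (ambient_dim C).
Variables (K : fieldType) (phi : {rmorphism {mpoly F[N.+1]} -> K}).
Hypothesis phiK : is_function_field phi.
Implicit Types p q : {mpoly F[N.+1]}.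

Lemma common_denominator n (a : 'I_n -> K) : exists d q (p : 'I_n -> {mpoly F[N.+1]}),
  [/\ q \is d.-homog, phi q <> 0, forall i, p i \is d.-homog & forall i, a i = phi (p i) / phi q].
Proof.
elim: n a => [|n IH] a.
  exists 0%N, 1, (fun=> 1); split=> [||[]//|[]//]; first by rewrite dhomog1.
  by rewrite rmorph1; apply/eqP; rewrite oner_eq0.
have [e [p0 [q0 [hp0 hq0 q00 a0]]]] := phiK.2 (a ord0).
have [d [q [p [hq q_0 hp aP]]]] := IH (fun i => a (lift ord0 i)).
exists (e + d)%N, (q0 * q), (fun i => if unlift ord0 i is Some j then q0 * p j else p0 * q).
move/eqP: q_0 => q_0; move/eqP: q00 => q00.
split=> [||i|i]; first exact: dhomogM.
- by apply/eqP; rewrite rmorphM mulf_neq0.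
- by case: unliftP => [j _|_]; apply: dhomogM.
- case: unliftP => [j ->|->]; rewrite ?aP ?a0 !rmorphM.
    by rewrite -[RHS]mulf_div divff // mul1r.
  by rewrite -[RHS]mulf_div [X in _ = _ * X]divff // mulr1.
Qed.

Let I p := phi p = 0.

Lemma kernel_ideal : is_ideal I.
Proof.
split=> [|p q|p q]; rewrite /I ?rmorph0 //.
  by rewrite rmorphD => -> ->; rewrite addr0.
by rewrite rmorphM => ->; rewrite mulr0.
Qed.

(** If [H (2 * d + e)] were at least [3 * H d] for every [d], then [H] would grow
    at least like [d ^ (log 3 / log 2)], which is not linear. *)
Lemma linear_growth_gap (H : nat -> nat) (e A B : nat) :
  (0 < H 0)%N -> (forall d, (H d <= A * d + B)%N) ->
  exists d, (H (2 * d + e) < 3 * H d)%N.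
Proof.
move=> H0 Hle; apply: contrapT => no.
have Hge d : (3 * H d <= H (2 * d + e))%N.
  by rewrite leqNgt; apply/negP => lt; apply: no; exists d.
(* The sequence with dd (j + 1) = 2 * dd j + e, along which H at least triples. *)
pose dd j := iter j (fun d => 2 * d + e)%N 0%N.
have Hj j : (3 ^ j <= H (dd j))%N.
  elim: j => [|j IH] //; apply: leq_trans (Hge (dd j)).
  by rewrite expnS leq_mul2l.
have ddj j : (dd j + e = 2 ^ j * e)%N.
  elim: j => [|j IH]; first by rewrite mul1n.
  by rewrite expnS -mulnA -IH /= -/(dd j); ring.
pose M := (A * e + B)%N.
have le32 j : (3 ^ j <= 2 ^ j * M)%N.
  apply: leq_trans (Hj j) (leq_trans (Hle _) _).
  rewrite mulnDr leq_add //; last by rewrite leq_pmull // expn_gt0.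
  by rewrite mulnCA leq_mul2l -ddj leq_addr orbT.
have := le32 (2 * M)%N; rewrite !expnM.
have : (8 ^ M <= (3 ^ 2) ^ M)%N.
  by case: (M) => // M'; rewrite leq_exp2r.
move=> /leq_trans h /h; rewrite -[8%N]/((2 ^ 2) * 2)%N expnMn leq_pmul2l ?expn_gt0 //.
by rewrite leqNgt ltn_expl.
Qed.

(** The entries of a zero are sought among forms of degree [d] on the curve:
    with [H d] the dimension of the space of such forms, this is a system of
    [H (2 * d + e)] quadrics in [3 * H d] unknowns. *)
Theorem tsen_ternary (G : 'M[K]_3) :
  exists2 x : 'rV[K]_3, x != 0 & x *m G *m x^T = 0.
Proof.
have idI := kernel_ideal; have sbI := ideal_subspace idI.
have [e [Q [P' [hQ Q0 hP' GP']]]] :=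
  common_denominator (fun k : 'I_#|{: 'I_3 * 'I_3}| => G (enum_val k).1 (enum_val k).2).
pose P i j := P' (enum_rank (i, j)).
have hP i j : P i j \is e.-homog by exact: hP'.
have GP i j : G i j = phi (P i j) / phi Q.
  by have := GP' (enum_rank (i, j)); rewrite enum_rankK.
have ex_basis d : exists h, exists b : 'I_h -> {mpoly F[N.+1]},
    [/\ forall i, b i \is d.-homog, free_mod I b & forall p, p \is d.-homog -> span_mod I b p].
  have [h [b [freeb bX spanb]]] := basis_mod_exists sbI
    (fun m : 'X_{1..N.+1 < d.+1} => if mdeg m == d then 'X_[F, m] else 0).
  exists h, b; split=> // [i|p hp].
    by case: (bX i) => m ->; case: eqP => [em|_]; rewrite ?rpred0 // dhomogX; exact/eqP.
  exact: span_mod_trans spanb (homog_span_mod sbI hp).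
have [H basis] : exists H : nat -> nat, forall d, exists b : 'I_(H d) -> {mpoly F[N.+1]},
    [/\ forall i, b i \is d.-homog, free_mod I b & forall p, p \is d.-homog -> span_mod I b p].
  by exists (fun d => sval (cid (ex_basis d))) => d; exact: svalP (cid (ex_basis d)).
have [A [B HAB]] : exists A B, forall d h (b : 'I_h -> {mpoly F[N.+1]}),
    (forall i, b i \is d.-homog) -> free_mod I b -> (h <= A * d + B)%N.
  by apply: hilbert_linear => // d p hp; exact: (phiK.1 d p hp).2.
have [||d ltH] := @linear_growth_gap H e A B.
- rewrite lt0n; apply/eqP => H0; case: (basis 0%N) => b [_ _ /(_ 1)].
  rewrite dhomog1 => /(_ isT)[c]; rewrite big1 => [|i]; last first.
    by have := ltn_ord i; rewrite [X in (_ < X)%N]H0.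
  by rewrite subr0 /I rmorph1 => /eqP; rewrite oner_eq0.
- by move=> d; case: (basis d) => b [hb freeb _]; exact: HAB hb freeb.
have [b [hb freeb spanb]] := basis d.
have [b' [hb' freeb' spanb']] := basis (2 * d + e)%N.
pose J := ('I_3 * 'I_(H d))%type.
have prod (u v : J) : exists c : 'I_(H (2 * d + e)) -> F,
    phi (P u.1 v.1 * (b u.2 * b v.2)) = phi (\sum_k c k *: b' k).
  have : P u.1 v.1 * (b u.2 * b v.2) \is (2 * d + e).-homog.
    by rewrite addnC mul2n -addnn; do 2 apply: dhomogM => //.
  by case/spanb' => c; rewrite /I rmorphB => /eqP; rewrite subr_eq0 => /eqP; exists c.
pose c u v := sval (cid (prod u v)).
have cP u v : phi (P u.1 v.1 * (b u.2 * b v.2)) = phi (\sum_k c u v k *: b' k).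
  by rewrite /c; case: cid.
pose X (u : J) : {mpoly F[#|{: J}|]} := 'X_(enum_rank u).
pose q k : {mpoly F[#|{: J}|]} := \sum_u \sum_v c u v k *: (X u * X v).
have hq k : q k \is 2.-homog.
  apply: rpred_sum => u _; apply: rpred_sum => v _; apply: dhomogZ.
  by apply: (@dhomogM _ _ _ 1 _ 1); rewrite dhomogX; apply/eqP; exact: mdeg1.
have [|w [j wj] qw] := quadrics_common_zero _ hq; first by rewrite card_prod !card_ord.
pose z (u : J) := w (enum_rank u).
have qz k : \sum_u \sum_v c u v k * (z u * z v) = 0.
  apply: etrans (qw k); rewrite /q [RHS]raddf_sum; apply: eq_bigr => u _ /=.
  rewrite [RHS]raddf_sum; apply: eq_bigr => v _ /=.
  by rewrite mevalZ mevalM !mevalXU.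
pose y i := \sum_s z (i, s) *: b s.
pose x : 'rV[K]_3 := \row_i phi (y i).
exists x.
  apply/eqP => x0; case/eqP: wj.
  have : phi (y (enum_val j).1) = 0.
    by have := congr1 (fun u : 'rV[K]_3 => u 0 (enum_val j).1) x0; rewrite !mxE.
  by move/freeb/(_ (enum_val j).2); rewrite /z -surjective_pairing enum_valK.
have yE i : y i = \sum_(u : J | u.1 == i) z u *: b u.2.
  rewrite /y; rewrite (reindex_onto (fun s => (i, s)) snd) /=; last by case=> i' s /eqP /= ->.
  by apply: eq_bigl => s; rewrite !eqxx.
have sum0 : \sum_i \sum_j P i j * (y i * y j) =
     \sum_u \sum_v (z u * z v) *: (P u.1 v.1 * (b u.2 * b v.2)).
  rewrite [RHS](partition_big (fun u : J => u.1) xpredT) //=; apply: eq_bigr => i _.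
  under [RHS]eq_bigr do rewrite (partition_big (fun u : J => u.1) xpredT) //=.
  rewrite exchange_big /=; apply: eq_bigr => i' _.
  rewrite !yE big_distrlr /= mulr_sumr; apply: eq_bigr => u /eqP <-.
  rewrite mulr_sumr; apply: eq_bigr => v /eqP <-.
  by rewrite -scalerAl -!scalerAr scalerA.
have phi0 : phi (\sum_i \sum_j P i j * (y i * y j)) = 0.
  rewrite sum0 rmorph_sum /=.
  have -> : \sum_u phi (\sum_v (z u * z v) *: (P u.1 v.1 * (b u.2 * b v.2))) =
     phi (\sum_k (\sum_u \sum_v c u v k * (z u * z v)) *: b' k).
    under [in RHS]eq_bigr do rewrite scaler_suml.
    rewrite exchange_big rmorph_sum /=; apply: eq_bigr => u _.
    under [in RHS]eq_bigr do rewrite scaler_suml.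
    rewrite exchange_big !rmorph_sum /=; apply: eq_bigr => v _.
    rewrite -!mul_mpolyC rmorphM /= cP -rmorphM; congr (phi _).
    rewrite mulr_sumr; apply: eq_bigr => k _.
    by rewrite mul_mpolyC scalerA mulrC.
  by rewrite big1 ?rmorph0 // => k _; rewrite qz scale0r.
apply/matrixP => i0 j0; rewrite !ord1 !mxE.
have -> : \sum_j0 (x *m G) 0 j0 * x^T j0 0 = phi (\sum_i \sum_j P i j * (y i * y j)) / phi Q.
  rewrite [in RHS]exchange_big /= rmorph_sum /= mulr_suml /=; apply: eq_bigr => j' _.
  rewrite [(x *m G) _ _]mxE [in RHS]rmorph_sum /= !mulr_suml /=; apply: eq_bigr => i' _.
  by rewrite !mxE GP !rmorphM; ring.
by rewrite phi0 mul0r.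
Qed.

End Tsen.

(** * Isotropic subspaces *)

Section IsotropicSubspace.
Variables (K : fieldType).
Hypothesis ternary : forall G : 'M[K]_3, exists2 x : 'rV[K]_3, x != 0 & x *m G *m x^T = 0.

(** If [W] is isotropic of dimension [j < n], then the quotient of its
    orthogonal by [W] has dimension at least [2 * n + 1 - 2 * j >= 3], hence
    contains an isotropic line. *)
Lemma isotropic_subspace_exists (n : nat) (G : 'M[K]_((2 * n).+1)) : G^T = G ->
  exists2 W : 'M[K]_(n, (2 * n).+1), row_free W & W *m G *m W^T = 0.
Proof.
move=> symG.
suff: forall j, (j <= n)%N -> exists2 W : 'M[K]_(j, (2 * n).+1), row_free W & W *m G *m W^T = 0.
  by move/(_ n (leqnn n)).
elim=> [|j IH] lejn; first by exists 0; rewrite ?mul0mx // /row_free mxrank0.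
have [W freeW WG] := IH (ltnW lejn).
pose U := kermx (G *m W^T).
have sWU : (W <= U)%MS by apply/sub_kermxP; rewrite mulmxA.
have rU : ((2 * n).+1 - j <= \rank U)%N.
  by rewrite mxrank_ker leq_sub2l // (leq_trans (rank_leq_col _)).
have r3 : (3 <= \rank (U :\: W)%MS)%N.
  have rE := mxrank_cap_compl U W.
  have rW : \rank (U :&: W)%MS = j by rewrite (capmx_idPr sWU); exact/eqP.
  by rewrite rW in rE; lia.
pose B : 'M[K]_(3, (2 * n).+1) := pid_mx 3 *m row_base (U :\: W)%MS.
have freeB : row_free B.
  rewrite /B /row_free mxrankMfree ?row_base_free // rank_pid_mx //.
have sB : (B <= U :\: W)%MS by rewrite /B (submx_trans (submxMl _ _)) // eq_row_base.
have [y y0 yG] := ternary (B *m G *m B^T).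
pose u := y *m B.
have u0 : u != 0 by rewrite mulmx_free_eq0.
have uG : u *m G *m u^T = 0 by rewrite -yG /u trmx_mul !mulmxA.
have suUW : (u <= U :\: W)%MS by rewrite (submx_trans (submxMl _ _)).
clearbody u.
have uGW : u *m G *m W^T = 0.
  by rewrite -mulmxA; apply/sub_kermxP; apply: submx_trans suUW (diffmxSl _ _).
have WGu : W *m G *m u^T = 0.
  by apply: trmx_inj; rewrite trmx0 !trmx_mul trmxK symG mulmxA uGW.
have uW : ~~ (u <= W)%MS.
  apply: contra u0 => suW; rewrite -submx0 -(capmx_diff U W) sub_capmx suUW.
  exact: suW.
rewrite -addn1.
exists (col_mx W u).
  rewrite /row_free -addsmxE.
  have := mxrank_sum_cap W u.
  have -> : \rank (W :&: u)%MS = 0%N.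
    apply/eqP; rewrite mxrank_eq0 -submx0 -(capmx_diff U W) sub_capmx.
    by rewrite capmxSl (submx_trans (capmxSr _ _)).
  by rewrite addn0 rank_rV u0 (eqP freeW) => ->.
rewrite tr_col_mx mul_col_mx mul_col_mx mul_mx_row mul_mx_row WG WGu uGW uG.
by rewrite !row_mx0 col_mx0.
Qed.

End IsotropicSubspace.

(** * Saturation over a valuation ring *)

Lemma det_colsub_replace (R : comNzRingType) (n r : nat) (L : 'M[R]_(n, r)) (f : 'I_n -> 'I_r) :
  colsub f L = 1%:M ->
  forall i j, \det (colsub (fun k => if k == i then j else f k) L) = L i j.
Proof.
move=> sub1 i j; pose g := fun k => if k == i then j else f k; rewrite -/g.
have cof k : cofactor (colsub g L) k i = (k == i)%:R.
  have <- : \adj (1%:M : 'M[R]_n) i k = (k == i)%:R.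
    by rewrite -[\adj _]mul1mx mul_mx_adj det1 mxE eq_sym.
  rewrite mxE; congr (_ * \det _); apply/matrixP => a b; rewrite -sub1 !mxE /g.
  by rewrite eq_sym (negPf (neq_lift _ _)).
rewrite (expand_det_col _ i) (bigD1 i) //= cof eqxx mulr1 mxE /g eqxx.
rewrite big1 ?addr0 // => k /negPf ki.
by rewrite cof ki mulr0.
Qed.

Section Saturation.
Variables (K : fieldType) (O : K -> Prop).
Hypothesis O0 : O 0.
Hypothesis O1 : O 1.
Hypothesis OM : forall a b, O a -> O b -> O (a * b).
Hypothesis Oval : forall a, a != 0 -> O a \/ O a^-1.

Lemma valuation_min (T : eqType) (f : T -> K) (s : seq T) :
  (exists2 i, i \in s & f i != 0) ->
  exists i, [/\ i \in s, f i != 0 & forall j, j \in s -> O (f j / f i)].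
Proof.
elim: s => [|i s IH]; first by case.
case=> j; rewrite inE => js fj.
case: (pselect (exists2 k, k \in s & f k != 0)) => [/IH[k [ks fk kmin]]|no]; last first.
  have ji : j = i.
    case/orP: js => [/eqP//|js]; by case: no; exists j.
  exists i; rewrite -ji fj mem_head; split=> // k; rewrite inE => /orP[/eqP->|ks].
    by rewrite divff.
  have -> : f k = 0 by apply/eqP; apply: contrapT => /negP fk; case: no; exists k.
  by rewrite mul0r.
case: (eqVneq (f i) 0) => [fi0|fi].
  exists k; rewrite inE ks orbT; split=> // l; rewrite inE => /orP[/eqP->|/kmin//].
  by rewrite fi0 mul0r.
have [h|h] := Oval (a := f i / f k) (mulf_neq0 fi (invr_neq0 fk)).
  by exists k; rewrite inE ks orbT; split=> // l; rewrite inE => /orP[/eqP->|/kmin].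
exists i; rewrite mem_head; split=> // l; rewrite inE => /orP[/eqP->|/kmin hl].
  by rewrite divff.
by have := OM hl h; rewrite invf_div mulrA divfK.
Qed.

(** Among the maximal minors of [M], one divides all the others. Multiplying
    [M] by the inverse of the corresponding submatrix makes that submatrix the
    identity, and the other entries are quotients of maximal minors by
    Cramer's rule. *)
Lemma saturation (n r : nat) (M : 'M[K]_(n, r)) : row_free M ->
  exists2 P : 'M[K]_n, P \in unitmx &
    (forall i j, O ((P *m M) i j)) /\
    exists f : 'I_n -> 'I_r, colsub f (P *m M) = 1%:M.
Proof.
move=> freeM.
pose m (f : {ffun 'I_n -> 'I_r}) := \det (colsub f M).
have [f0 f00] : exists f, m f != 0.
  have fullMT : row_full M^T by rewrite /row_full mxrank_tr.
  have := fullrowsub_unit fullMT.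
  move: (fullrankfun fullMT) => g rg; exists [ffun i => g i].
  rewrite /m -unitfE -[_ \is a _]/(_ \in unitmx) -unitmx_tr.
  have -> : (colsub [ffun i => g i] M)^T = rowsub g M^T by apply/matrixP => i j; rewrite !mxE ffunE.
  exact: rg.
have [f [_ mf fmin]] := valuation_min (f := m) (s := enum {ffun 'I_n -> 'I_r}) (ex_intro2 _ _ f0 (mem_enum _ _) f00).
pose A := colsub f M.
have uA : A \in unitmx by rewrite unitmxE unitfE.
exists (invmx A); first by rewrite unitmx_inv.
have sub1 : colsub f (invmx A *m M) = 1%:M.
  by rewrite -(mulVmx uA) /A; apply/matrixP => i j; rewrite !mxE; apply: eq_bigr => k _; rewrite !mxE.
split; last by exists f.
move=> i j; set L := invmx A *m M.
pose g : {ffun 'I_n -> 'I_r} := [ffun k => if k == i then j else f k].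
have -> : L i j = m g / m f.
  rewrite -(det_colsub_replace sub1 i j).
  have -> : colsub (fun k => if k == i then j else f k) L = invmx A *m colsub g M.
    apply/matrixP => k l; rewrite !mxE; apply: eq_bigr => k' _.
    by rewrite !mxE ffunE.
  by rewrite det_mulmx det_inv mulrC.
by apply: fmin; rewrite mem_enum.
Qed.

End Saturation.

(** * Values of rational functions *)

Section Values.
Variables (F : closedFieldType) (C : curve F).
Notation N := (ambient_dim C).
Variables (K : fieldType) (phi : {rmorphism {mpoly F[N.+1]} -> K}).
Hypothesis phiK : is_function_field phi.
Implicit Types (p q : {mpoly F[N.+1]}) (a b : K) (x y : C).

Lemma phi_form0 d p : p \is d.-homog -> (phi p = 0 <-> forall x, ev p x = 0).
Proof. exact: phiK.1. Qed.

Lemma phi_neq0 d q x : q \is d.-homog -> ev q x <> 0 -> phi q != 0.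
Proof. by move=> hq qx; apply/eqP => /(phi_form0 hq)/(_ x). Qed.

(** A relation, as [a] may have a pole at [x]; the quotient of forms depends on
    the point, since no single one need be defined wherever [a] is regular. *)
Definition regval a x (c : F) : Prop := exists d p q,
  [/\ p \is d.-homog, q \is d.-homog, ev q x <> 0, a = phi p / phi q & c = ev p x / ev q x].

Definition const_fun (c : F) : K := phi c%:MP.

Lemma regval_quot d p q x : p \is d.-homog -> q \is d.-homog -> ev q x <> 0 ->
  regval (phi p / phi q) x (ev p x / ev q x).
Proof. by move=> hp hq qx; exists d, p, q. Qed.

Lemma regval_uniq a x c c' : regval a x c -> regval a x c' -> c = c'.
Proof.
case=> d [p [q [hp hq qx aE ->]]] [d' [p' [q' [hp' hq' qx' aE' ->]]]].
move/eqP: aE'; rewrite aE eqr_div ?(phi_neq0 hq qx) ?(phi_neq0 hq' qx') //.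
rewrite -subr_eq0 -!rmorphM -rmorphB => /eqP.
have h1 : p * q' \is (d + d').-homog by exact: dhomogM.
have h2 : p' * q \is (d + d').-homog by rewrite addnC; exact: dhomogM.
move/(phi_form0 (rpredB h1 h2))/(_ x); rewrite !evr => /eqP; rewrite subr_eq0 => e.
by apply/eqP; rewrite eqr_div //; apply/eqP.
Qed.

Lemma regval_cst c x : regval (const_fun c) x c.
Proof.
exists 0%N, c%:MP, 1; split; rewrite ?ev1 ?rmorph1 ?divr1 ?evE ?mevalC //.
- by rewrite -alg_mpolyC; apply: dhomogZ; rewrite dhomog1.
- by rewrite dhomog1.
- by apply/eqP; rewrite oner_eq0.
Qed.

Lemma cst0 : const_fun 0 = 0. Proof. by rewrite /const_fun !rmorph0. Qed.
Lemma cst1 : const_fun 1 = 1. Proof. by rewrite /const_fun !rmorph1. Qed.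

Lemma regval0 x : regval 0 x 0. Proof. by rewrite -cst0; exact: regval_cst. Qed.
Lemma regval1 x : regval 1 x 1. Proof. by rewrite -cst1; exact: regval_cst. Qed.

Lemma regvalD a b x c c' : regval a x c -> regval b x c' -> regval (a + b) x (c + c').
Proof.
case=> d [p [q [hp hq qx -> ->]]] [d' [p' [q' [hp' hq' qx' -> ->]]]].
exists (d + d')%N, (p * q' + p' * q), (q * q'); split.
- by apply: rpredD; [exact: dhomogM | rewrite addnC; exact: dhomogM].
- exact: dhomogM.
- by rewrite evM; apply/eqP; rewrite mulf_neq0 //; apply/eqP.
- by rewrite addf_div ?(phi_neq0 hq qx) ?(phi_neq0 hq' qx') // rmorphD !rmorphM.
- by rewrite addf_div ?evr //; apply/eqP.
Qed.

Lemma regvalM a b x c c' : regval a x c -> regval b x c' -> regval (a * b) x (c * c').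
Proof.
case=> d [p [q [hp hq qx -> ->]]] [d' [p' [q' [hp' hq' qx' -> ->]]]].
exists (d + d')%N, (p * p'), (q * q'); split; try exact: dhomogM.
- by rewrite evM; apply/eqP; rewrite mulf_neq0 //; apply/eqP.
- by rewrite mulf_div !rmorphM.
- by rewrite mulf_div !evM.
Qed.

Lemma regvalN a x c : regval a x c -> regval (- a) x (- c).
Proof.
move=> h; rewrite -mulN1r -[- c]mulN1r; apply: regvalM h.
have -> : -1 = const_fun (-1) by rewrite /const_fun !rmorphN !rmorph1.
exact: regval_cst.
Qed.

Lemma regvalB a b x c c' : regval a x c -> regval b x c' -> regval (a - b) x (c - c').
Proof. by move=> h h'; apply: regvalD => //; apply: regvalN. Qed.

Lemma regvalV a x c : regval a x c -> c <> 0 -> regval a^-1 x c^-1.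
Proof.
case=> d [p [q [hp hq qx -> ->]]] c0; exists d, q, p; split; rewrite ?invf_div //.
by move=> px; apply: c0; rewrite px mul0r.
Qed.

Lemma regval_sum (J : finType) (a : J -> K) (c : J -> F) x :
  (forall j, regval (a j) x (c j)) -> regval (\sum_j a j) x (\sum_j c j).
Proof. by move=> h; elim/big_ind2: _ => // [|? ? ? ?]; [exact: regval0 | exact: regvalD]. Qed.

Lemma regval_prod (J : finType) (a : J -> K) (c : J -> F) x :
  (forall j, regval (a j) x (c j)) -> regval (\prod_j a j) x (\prod_j c j).
Proof. by move=> h; elim/big_ind2: _ => // [|? ? ? ?]; [exact: regval1 | exact: regvalM]. Qed.

Definition regmx m n (A : 'M[K]_(m, n)) x (B : 'M[F]_(m, n)) : Prop :=
  forall i j, regval (A i j) x (B i j).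

Lemma regmx_uniq m n (A : 'M[K]_(m, n)) x B B' : regmx A x B -> regmx A x B' -> B = B'.
Proof. by move=> h h'; apply/matrixP => i j; exact: regval_uniq (h i j) (h' i j). Qed.

Lemma regmx_mul m n k (A : 'M[K]_(m, n)) (A' : 'M[K]_(n, k)) x B B' :
  regmx A x B -> regmx A' x B' -> regmx (A *m A') x (B *m B').
Proof.
by move=> h h' i j; rewrite !mxE; apply: regval_sum => l; exact: regvalM.
Qed.

Lemma regmx_cst m n (A : 'M[F]_(m, n)) x : regmx (map_mx const_fun A) x A.
Proof. by move=> i j; rewrite mxE; exact: regval_cst. Qed.

Lemma regmx_tr m n (A : 'M[K]_(m, n)) x B : regmx A x B -> regmx A^T x B^T.
Proof. by move=> h i j; rewrite !mxE. Qed.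

Lemma regmx1 n x : @regmx n n 1%:M x 1%:M.
Proof. by move=> i j; rewrite !mxE; case: (i == j); [exact: regval1 | exact: regval0]. Qed.

Lemma regval_sign k x : regval ((-1) ^+ k) x ((-1) ^+ k).
Proof.
elim: k => [|k IH]; first by rewrite !expr0; exact: regval1.
by rewrite !exprS; apply: regvalM => //; apply: regvalN; exact: regval1.
Qed.

Lemma regval_det n (A : 'M[K]_n) x B : regmx A x B -> regval (\det A) x (\det B).
Proof.
move=> h; apply: regval_sum => s; apply: regvalM; first exact: regval_sign.
by apply: regval_prod => i.
Qed.

Lemma regmx_adj n (A : 'M[K]_n) x B : regmx A x B -> regmx (\adj A) x (\adj B).
Proof.
move=> h i j; rewrite !mxE; apply: regvalM.
  exact: regval_sign.
by apply: regval_det => k l; rewrite !mxE.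
Qed.

Lemma regmx_inv n (A : 'M[K]_n) x B : regmx A x B -> B \in unitmx ->
  A \in unitmx /\ regmx (invmx A) x (invmx B).
Proof.
move=> h uB; have dB := uB; rewrite unitmxE unitfE in dB.
have hd := regval_det h.
have uA : A \in unitmx.
  rewrite unitmxE unitfE; apply: contraNneq dB => dA; rewrite dA in hd.
  by rewrite (regval_uniq hd (regval0 x)).
split=> // i j; rewrite /invmx uA uB !mxE; apply: regvalM.
  by apply: regvalV hd _; apply/eqP.
by have := regmx_adj h i j; rewrite !mxE.
Qed.

Lemma regval_opn a x c : regval a x c -> exists W : C -> Prop, [/\ opn W, W x &
  exists d p q, [/\ p \is d.-homog, q \is d.-homog &
    forall y, W y -> ev q y <> 0 /\ regval a y (ev p y / ev q y)]].
Proof.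
case=> d [p [q [hp hq qx aE cE]]]; exists (fun y => ev q y <> 0); split=> //.
  exact: opn_form hq.
by exists d, p, q; split=> // y qy; split=> //; rewrite aE; exact: regval_quot hp hq qy.
Qed.

Lemma regval_regular_on a (U : C -> Prop) (f : C -> F) :
  (forall x, U x -> regval a x (f x)) -> regular_on U f.
Proof.
move=> h x Ux; have [W [oW Wx [d [p [q [hp hq WP]]]]]] := regval_opn (h x Ux).
exists W; split=> //; exists d, p, q; split=> // y Wy Uy; have [qy rv] := WP y Wy.
by split=> //; exact: regval_uniq (h y Uy) rv.
Qed.

(** By irreducibility, any two local expressions agree on a nonempty open set,
    and therefore define the same rational function. *)
Lemma regular_on_regval (U : C -> Prop) (f : C -> F) x0 : opn U -> U x0 ->
  regular_on U f -> exists a, forall x, U x -> regval a x (f x).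
Proof.
move=> oU Ux0 rf; have [W [oW Wx [d [p [q [hp hq WP]]]]]] := rf x0 Ux0.
exists (phi p / phi q) => y Uy.
have [W' [oW' Wy [d' [p' [q' [hp' hq' WP']]]]]] := rf y Uy.
have [qx _] := WP x0 Wx Ux0; have [q'y ->] := WP' y Wy Uy.
exists d', p', q'; split=> //.
apply/eqP; rewrite eqr_div ?(phi_neq0 hq qx) ?(phi_neq0 hq' q'y) //.
rewrite -subr_eq0 -!rmorphM -rmorphB; apply/eqP.
have h1 : p * q' \is (d + d').-homog by exact: dhomogM.
have h2 : p' * q \is (d + d').-homog by rewrite addnC; exact: dhomogM.
apply/(phi_form0 (rpredB h1 h2)).
have [z [[Wz Uz] W'z]] := opn_meet (opnI oW oU) oW' (conj Wx Ux0) Wy.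
apply: (opn_form_vanish (rpredB h1 h2) (opnI (opnI oW oU) oW') (conj (conj Wz Uz) W'z)).
move=> w [[Ww Uw] W'w]; rewrite !evr; apply/eqP; rewrite subr_eq0.
have [/eqP qw fw] := WP w Ww Uw; have [/eqP q'w fw'] := WP' w W'w Uw.
by rewrite -eqr_div // -fw -fw'.
Qed.

Lemma regmx_of_regular_on m n (U : C -> Prop) (f : C -> 'M[F]_(m, n)) x0 : opn U -> U x0 ->
  (forall i j, regular_on U (fun x => f x i j)) ->
  exists A : 'M[K]_(m, n), forall x, U x -> regmx A x (f x).
Proof.
move=> oU Ux0 rf; have ex i j := regular_on_regval oU Ux0 (rf i j).
exists (\matrix_(i, j) sval (cid (ex i j))) => x Ux i j.
by rewrite mxE; case: cid => a /=; apply.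
Qed.

Lemma regval_eq0 a (U : C -> Prop) x0 : opn U -> U x0 ->
  (forall x, U x -> regval a x 0) -> a = 0.
Proof.
move=> oU Ux0 h; have [W [oW Wx [d [p [q [hp hq WP]]]]]] := regval_opn (h x0 Ux0).
have [d' [p' [q' [hp' hq' q'x aE _]]]] := h x0 Ux0.
have p0 : phi p' = 0.
  apply/(phi_form0 hp'); apply: (opn_form_vanish hp' (opnI oU (opn_form hq')) (conj Ux0 q'x)).
  move=> y [Uy q'y]; have e : regval a y (ev p' y / ev q' y) by rewrite aE; exact: regval_quot hp' hq' q'y.
  by move/eqP: (regval_uniq e (h y Uy)); rewrite mulf_eq0 invr_eq0 => /orP[/eqP//|/eqP].
by rewrite aE p0 mul0r.
Qed.

Lemma regmx_eq m n (A A' : 'M[K]_(m, n)) (U : C -> Prop) x0 : opn U -> U x0 ->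
  (forall x, U x -> exists2 B, regmx A x B & regmx A' x B) -> A = A'.
Proof.
move=> oU Ux0 h; apply/matrixP => i j; apply/eqP; rewrite -subr_eq0; apply/eqP.
apply: (regval_eq0 oU Ux0) => x /h[B hB hB']; rewrite -(subrr (B i j)).
exact: regvalB.
Qed.

End Values.

(** * Local rings of a smooth curve *)

Lemma euler_identity (F : fieldType) n (p : {mpoly F[n]}) d (v : 'I_n -> F) :
  p \is d.-homog -> \sum_j v j * (p^`M(j)).@[v] = d%:R * p.@[v].
Proof.
move=> /dhomogP hp.
have dE j : p^`M(j) = \sum_(m <- msupp p) p@_m *: ((m j)%:R *: 'X_[m - U_(j)]).
  rewrite {1}(mpolyE p) (linear_sum (mderiv j)) /=; apply: eq_bigr => m _.
  by rewrite mderivZ mderivX.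
rewrite [in RHS](mpolyE p) (raddf_sum (meval v)) mulr_sumr /=.
under eq_bigr do rewrite dE (raddf_sum (meval v)) mulr_sumr /=.
rewrite exchange_big /= !big_seq; apply: eq_bigr => m /hp; rewrite /= => <-.
rewrite mevalZ mdegE natr_sum mulr_suml; apply: eq_bigr => j _; rewrite !mevalZ.
case: (posnP (m j)) => [->|mj]; first by rewrite !mul0r !mulr0.
have -> : 'X_[m] = 'X_[m - U_(j)] * 'X_j :> {mpoly F[n]}.
  by rewrite -mpolyXD submK // lep1mP -lt0n.
by rewrite mevalM mevalXU; ring.
Qed.

Section LocalRing.
Variables (F : closedFieldType) (C : curve F).
Notation N := (ambient_dim C).
Variables (K : fieldType) (phi : {rmorphism {mpoly F[N.+1]} -> K}).
Hypothesis phiK : is_function_field phi.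
Variable x : C.
Implicit Types (p q : {mpoly F[N.+1]}) (a b : K).
Notation regval := (regval phi).
Notation cst := (const_fun phi).

Definition regular_at a : Prop := exists c, regval a x c.
Notation O := regular_at.
Notation m a := (regval a x 0).

Lemma regular_atD a b : O a -> O b -> O (a + b).
Proof. by case=> c h [c' h']; exists (c + c'); exact: regvalD. Qed.
Lemma regular_atM a b : O a -> O b -> O (a * b).
Proof. by case=> c h [c' h']; exists (c * c'); exact: regvalM. Qed.
Lemma regular_at0 : O 0. Proof. by exists 0; exact: regval0. Qed.
Lemma regular_at1 : O 1. Proof. by exists 1; exact: regval1. Qed.
Lemma regular_at_sum (J : finType) (a : J -> K) : (forall j, O (a j)) -> O (\sum_j a j).
Proof. by move=> h; elim/big_ind: _ => //; [exact: regular_at0 | exact: regular_atD]. Qed.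

Lemma maxM a b : O a -> m b -> m (a * b).
Proof. by case=> c ha hb; have := regvalM ha hb; rewrite mulr0. Qed.

Lemma maxD a b : m a -> m b -> m (a + b).
Proof. by move=> ha hb; have := regvalD phiK ha hb; rewrite addr0. Qed.

Lemma max_sum (J : finType) (a : J -> K) : (forall j, m (a j)) -> m (\sum_j a j).
Proof. by move=> h; elim/big_ind: _ => //; [exact: regval0 | exact: maxD]. Qed.

Let v := coords x 0.

Let ex_k : exists k, v k != 0. Proof. exact: rep_coord. Qed.
Let k := sval (cid ex_k).
Let vk : v k != 0. Proof. exact: (svalP (cid ex_k)). Qed.

Let phiXk : phi 'X_k != 0.
Proof. by apply: (phi_neq0 phiK (homogX1 k) (x := x)); rewrite evE mevalXU; exact/eqP. Qed.

(* Affine coordinates, normalized so as to take the value [v] at [x]. *)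
Let Y j := cst (v k) * (phi 'X_j / phi 'X_k).
Let z j := Y j - cst (v j).
Let psi := mmap (phi \o @mpolyC N.+1 F) Y.

Let psi_rmorph : {rmorphism {mpoly F[N.+1]} -> K} := mmap (phi \o @mpolyC N.+1 F) Y.

Let psiE p : psi_rmorph p = psi p. Proof. by []. Qed.

Let Yval j : regval (Y j) x (v j).
Proof.
have -> : v j = v k * (ev 'X_j x / ev 'X_k x).
  by rewrite !evE !mevalXU mulrCA divff ?mulr1.
apply: regvalM => //; first exact: regval_cst.
by apply: regval_quot (homogX1 _) (homogX1 _) _; rewrite evE mevalXU; exact/eqP.
Qed.

Let zval j : m (z j).
Proof. by rewrite -(subrr (v j)); apply: regvalB => //; exact: regval_cst. Qed.

Let zk : z k = 0.
Proof. by rewrite /z /Y divff // mulr1 subrr. Qed.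

Let psi_val p : regval (psi p) x (p.@[v]).
Proof.
rewrite /psi /mmap mevalE; elim/big_ind2: _ => [|????|i _]; first exact: regval0.
  exact: regvalD.
apply: regvalM => //; first exact: regval_cst.
apply: regval_prod => // j.
elim: (i j) => [|l IH]; first by rewrite !expr0; exact: regval1.
by rewrite !exprS; exact: regvalM.
Qed.

Let psi_homog d p : p \is d.-homog -> phi p = (phi 'X_k / cst (v k)) ^+ d * psi p.
Proof.
move=> /dhomogP hp; rewrite {1}(mpolyE p) raddf_sum /psi /mmap mulr_sumr /= !big_seq.
apply: eq_bigr => i /hp <-.
rewrite -mul_mpolyC rmorphM /= mulrCA; congr (_ * _).
rewrite mpolyXE_id rmorph_prod mdegE -prodrXr -big_split /=; apply: eq_bigr => j _.
rewrite rmorphXn -exprMn; congr (_ ^+ _) => /=.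
have cvk : cst (v k) != 0.
  by apply/eqP => e; move/eqP: vk; apply; apply: (regval_uniq phiK (regval_cst phi _ x)); rewrite e; exact: regval0.
by rewrite /Y [RHS]mulrA (divfK cvk) mulrCA divff // mulr1.
Qed.

Let quot_psi a : exists d p q, [/\ p \is d.-homog, q \is d.-homog, psi q != 0 & a = psi p / psi q].
Proof.
have [d [p [q [hp hq /eqP q0 ->]]]] := phiK.2 a; exists d, p, q; split=> //.
  by apply: contraNneq q0 => e; rewrite (psi_homog hq) e mulr0.
have /eqP := q0; rewrite (psi_homog hq) (psi_homog hp) => /eqP; rewrite mulf_eq0 negb_or => /andP[u0 _].
by rewrite -mulf_div divff // mul1r.
Qed.

Let O_psi a : O a -> exists p q, [/\ q.@[v] != 0, a = psi p / psi q & regval a x (p.@[v] / q.@[v])].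
Proof.
case=> c [d [p [q [hp hq /eqP qx aE cE]]]]; exists p, q; split=> //.
  have /eqP := phi_neq0 phiK hq (elimN eqP qx).
  rewrite aE (psi_homog hq) (psi_homog hp) => /eqP; rewrite mulf_eq0 negb_or => /andP[u0 _].
  by rewrite -mulf_div divff // mul1r.
by rewrite aE; apply: regval_quot hp hq (elimN eqP qx).
Qed.

(** The square of the maximal ideal, as combinations of the [z j] with
    coefficients in the maximal ideal. *)
Let sq a := exists2 h : 'I_N.+1 -> K, forall j, m (h j) & a = \sum_j h j * z j.

Let sqD a b : sq a -> sq b -> sq (a + b).
Proof.
case=> h hm -> [h' hm' ->]; exists (fun j => h j + h' j); first by move=> j; exact: maxD.
by rewrite -big_split; apply: eq_bigr => j _; rewrite mulrDl.
Qed.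

Let sqM a b : O a -> sq b -> sq (a * b).
Proof.
move=> ha [h hm ->]; exists (fun j => a * h j); first by move=> j; exact: maxM.
by rewrite mulr_sumr; apply: eq_bigr => j _; rewrite mulrA.
Qed.

Let sq0 : sq 0.
Proof. by exists (fun=> 0) => [j|]; [exact: regval0 | rewrite big1 // => j _; rewrite mul0r]. Qed.

Let sq_sum (J : Type) (r : seq J) (P : pred J) (a : J -> K) :
  (forall j, P j -> sq (a j)) -> sq (\sum_(j <- r | P j) a j).
Proof. by move=> h; elim/big_ind: _ => //; exact: sqD. Qed.

Let Ocst c : O (cst c). Proof. by exists c; exact: regval_cst. Qed.
Let Opsi p : O (psi p). Proof. by exists p.@[v]; exact: psi_val. Qed.

(* Modulo squares, [Z u] is the class of the covector [u]. *)
Let Z (u : 'I_N.+1 -> F) := \sum_j cst (u j) * z j.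

Let Zmax u : m (Z u).
Proof. by apply: max_sum => j; apply: maxM. Qed.

Let cstD c c' : cst (c + c') = cst c + cst c'. Proof. by rewrite /const_fun !rmorphD. Qed.
Let cstM c c' : cst (c * c') = cst c * cst c'. Proof. by rewrite /const_fun !rmorphM. Qed.

Let ZD u w : Z (fun j => u j + w j) = Z u + Z w.
Proof. by rewrite /Z -big_split; apply: eq_bigr => j _; rewrite cstD mulrDl. Qed.

Let ZZ c u : Z (fun j => c * u j) = cst c * Z u.
Proof. by rewrite /Z mulr_sumr; apply: eq_bigr => j _; rewrite cstM mulrA. Qed.

(** First-order expansion at [x]: a property stable under products, and obvious
    for constants and variables. *)
Let taylor p0 : sq (psi p0 - cst p0.@[v] - Z (fun j => (p0^`M(j)).@[v])).
Proof.
pose T p := sq (psi p - cst p.@[v] - Z (fun j => (p^`M(j)).@[v])).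
rewrite -/(T p0).
have TD p q : T p -> T q -> T (p + q).
  move=> hp hq; have := sqD hp hq; congr sq.
  rewrite -!psiE rmorphD mevalD cstD.
  rewrite [X in _ = _ - X](_ : _ = Z (fun j => (p^`M(j)).@[v]) + Z (fun j => (q^`M(j)).@[v])); first by ring.
  by rewrite -ZD /Z; apply: eq_bigr => j _; rewrite mderivD mevalD.
have TM p q : T p -> T q -> T (p * q).
  set Lp := Z (fun j => (p^`M(j)).@[v]); set Lq := Z (fun j => (q^`M(j)).@[v]).
  move=> hp hq.
  have LL : sq (Lp * Lq).
    exists (fun j => Lp * cst (q^`M(j)).@[v]) => [j|]; first by rewrite mulrC; apply: maxM => //; exact: Zmax.
    by rewrite /Lq /Z mulr_sumr; apply: eq_bigr => j _; rewrite mulrA.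
  have OL : O Lp by exists 0; exact: Zmax.
  have := sqD (sqD (sqM (Ocst p.@[v]) hq) LL) (sqD (sqM OL hq) (sqM (Opsi q) hp)).
  congr sq; rewrite -!psiE rmorphM mevalM cstM.
  rewrite [X in _ = _ - X](_ : _ = cst q.@[v] * Lp + cst p.@[v] * Lq); first by rewrite /Lp /Lq; ring.
  by rewrite -!ZZ -ZD /Z; apply: eq_bigr => j _; rewrite mderivM mevalD !mevalM [_ * q.@[v]]mulrC.
have TC c : T c%:MP.
  rewrite /T -psiE /psi_rmorph /= mmapC mevalC /= subrr sub0r.
  rewrite (_ : Z _ = 0) ?oppr0 // /Z big1 // => j _.
  by rewrite mderivC meval0 cst0 mul0r.
have TX i : T 'X_i.
  rewrite /T /psi mmapX mmap1U mevalXU.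
  rewrite (_ : Z _ = z i) ?subrr // /Z (bigD1 i) //= mderivX mnm1E eqxx scale1r.
  have -> : (U_(i) - U_(i))%MM = 0%MM :> 'X_{1..N.+1}.
    by apply/mnmP => l; rewrite mnmBE subnn mnm0E.
  rewrite mpolyX0 meval1 cst1 mul1r big1 ?addr0 // => j /negPf ji.
  by rewrite mderivX mnm1E eq_sym ji scale0r meval0 cst0 mul0r.
rewrite (mpolyE p0); elim/big_ind: _ => [||i _]; [by rewrite -mpolyC0; exact: TC | exact: TD |].
rewrite -mul_mpolyC; apply: (TM) => //; rewrite mpolyXE_id; elim/big_ind: _ => [||j _]; [by rewrite -mpolyC1; exact: TC | exact: TM |].
elim: (i j) => [|l IH]; first by rewrite expr0 -mpolyC1; exact: TC.
by rewrite exprS; apply: TM.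
Qed.

Let psi_equation f : f \in equations C -> psi f = 0.
Proof.
move=> fE; have [d hf] := equations_form fE.
have pf : phi f = 0 by apply/(phi_form0 phiK hf) => y; exact: ev_equation.
have /eqP := phiXk; move: pf; rewrite (psi_homog hf) => /eqP; rewrite mulf_eq0 expf_eq0.
case/orP=> [/andP[_]|/eqP//]; rewrite mulf_eq0 invr_eq0 => /orP[/eqP//|/eqP e] _.
case/eqP: vk; apply: (regval_uniq phiK (regval_cst phi _ x)); rewrite -/cst e.
exact: regval0.
Qed.

Let sq_jacobian i : sq (Z (jacobian (x : zero_locus (equations C)) i)).
Proof.
set f := (equations C)`_i.
have fE : f \in equations C by exact: mem_nth.
have csN1 : cst (-1) = -1 by rewrite /const_fun !rmorphN !rmorph1.
have fv : f.@[v] = 0 by exact: (ev_equation x fE).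
have := sqM (Ocst (-1)) (taylor f); rewrite psi_equation // fv cst0 subr0 sub0r csN1 mulrNN mul1r.
by congr sq; apply: eq_bigr => j _; rewrite !mxE.
Qed.

Lemma rank_adds_row m0 (A : 'M[F]_(m0, N.+1)) (u : 'rV[F]_N.+1) :
  ~~ (u <= A)%MS -> (\rank A < \rank (A + u)%MS)%N.
Proof.
move=> nuA; have : (A < A + u)%MS.
  rewrite ltmxE addsmxSl; apply: contra nuA => h.
  exact: submx_trans (addsmxSr _ _) h.
by rewrite ltmxErank => /andP[].
Qed.

(** By Euler's identity and the rank condition on the Jacobian matrix, its
    rows span a hyperplane of the space of covectors killing the line [x], so
    that all the [z j] are multiples of one of them modulo squares. *)
Let cotangent_line : exists t, forall j, exists c, sq (z j - cst c * z t).
Proof.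
set J := jacobian (x : zero_locus (equations C)).
pose e j : 'rV[F]_N.+1 := delta_mx 0 j.
have rJ : (\rank J + 1 = N)%N by exact: curve_smooth.
have Jv (u : 'rV_N.+1) : (u <= J)%MS -> \sum_j u 0 j * v j = 0.
  case/submxP=> w ->.
  under eq_bigr do rewrite mxE mulr_suml.
  rewrite exchange_big big1 //= => i _.
  under eq_bigr do rewrite -mulrA.
  rewrite -mulr_sumr.
  have fE : (equations C)`_i \in equations C by exact: mem_nth.
  have [d hf] := equations_form fE.
  have -> : \sum_j J i j * v j = \sum_j v j * ((equations C)`_i^`M(j)).@[v].
    by apply: eq_bigr => j _; rewrite !mxE mulrC.
  rewrite (euler_identity _ hf).
  by rewrite -[X in _ * (_ * X)]/(ev _ x) ev_equation // !mulr0.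
have nek : ~~ (e k <= J)%MS.
  apply/negP => /Jv; rewrite (bigD1 k) //= mxE !eqxx mul1r big1 ?addr0; first exact/eqP.
  by move=> j /negPf jk; rewrite mxE eqxx jk mul0r.
pose S := (J + e k)%MS.
have rS : (N <= \rank S)%N by apply: leq_trans (rank_adds_row nek); rewrite -[X in (_ <= X)%N]addn1 rJ.
(* Together with [e k], killed since [z k = 0], at most one more coordinate is
   missing. *)
have [t fullt] : exists t, (row_full (S + e t)%MS).
  apply: contrapT => no.
  have sub j : (e j <= S)%MS.
    apply: contrapT => /negP nej; apply: no; exists j.
    rewrite /row_full eqn_leq rank_leq_col; apply: leq_trans (rank_adds_row nej).
    by rewrite ltnS.
  apply: no; exists k; rewrite -sub1mx; apply/row_subP => j.
  by rewrite row1; apply: submx_trans (sub j) (addsmxSl _ _).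
exists t => j.
have : (e j <= S + e t)%MS by exact: submx_full.
case/sub_addsmxP=> -[u1 u2] /=.
have : (u1 *m S <= S)%MS by exact: submxMl.
case/sub_addsmxP=> -[w1 w2] /= ->.
move=> eE; exists (u2 0 0).
have delta i : Z (e i 0) = z i.
  rewrite /Z (bigD1 i) //= mxE !eqxx cst1 mul1r big1 ?addr0 // => l /negPf li.
  by rewrite mxE eqxx li cst0 mul0r.
have Zsum (I : finType) (u : I -> 'I_N.+1 -> F) : Z (fun l => \sum_i u i l) = \sum_i Z (u i).
  rewrite /Z exchange_big; apply: eq_bigr => l _; rewrite -mulr_suml; congr (_ * _).
  by rewrite /const_fun !rmorph_sum.
have ZM i (u : 'rV[F]_1) : Z ((u *m e i) 0) = cst (u 0 0) * z i.
  rewrite -delta -ZZ /Z; apply: eq_bigr => l _.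
  by rewrite mxE big_ord1.
have -> : z j = \sum_i cst (w1 0 i) * Z (J i) + cst (w2 0 0) * z k + cst (u2 0 0) * z t.
  rewrite -[LHS]delta eE -!ZM.
  have -> : \sum_i cst (w1 0 i) * Z (J i) = Z ((w1 *m J) 0).
    under eq_bigr do rewrite -ZZ.
    by rewrite -Zsum /Z; apply: eq_bigr => l _; rewrite mxE.
  by rewrite -!ZD /Z; apply: eq_bigr => l _; rewrite !mxE.
rewrite addrK zk mulr0 addr0; apply: sq_sum => i _; by apply: sqM.
Qed.

(** Nakayama's lemma: modulo the square of the maximal ideal, all the
    generators [z j] are multiples of [z t], so [(1 - H) z] is a multiple of
    [z t] for a matrix [H] with entries in the maximal ideal, and [1 - H] is
    invertible over the local ring. *)
Lemma max_principal : exists2 t, m t & forall a, m a -> exists2 g, O g & a = g * t.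
Proof.
have [t zt] := cotangent_line.
pose c j := sval (cid (zt j)).
have cP j : sq (z j - cst (c j) * z t) by exact: (svalP (cid (zt j))).
have ex_h j : exists h : 'I_N.+1 -> K, (forall l, m (h l)) /\ z j - cst (c j) * z t = \sum_l h l * z l.
  by case: (cP j) => h; exists h.
pose H : 'M[K]_N.+1 := \matrix_(j, l) sval (cid (ex_h j)) l.
have Hm j l : m (H j l).
  by rewrite mxE; case: cid => h /= [hm _].
have HE j : z j - cst (c j) * z t = \sum_l H j l * z l.
  under eq_bigr do rewrite mxE.
  by case: cid => h /= [_ hE].
have regA : regmx phi (1%:M - H) x 1%:M.
  move=> j l; rewrite !mxE -[X in regval _ _ X]subr0; apply: regvalB => //.
    by case: (j == l); [exact: regval1 | exact: regval0].
  by have := Hm j l; rewrite mxE.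
have [uA regV] := regmx_inv phiK regA (unitmx1 _ _).
have zE : \col_j z j = invmx (1%:M - H) *m (\col_j cst (c j) *m (z t)%:M).
  apply: (canRL (mulKmx uA)); rewrite mulmxBl mul1mx; apply/colP => j.
  rewrite !mxE big_ord1 !mxE mulr1n; apply/eqP; rewrite subr_eq addrC -subr_eq HE; apply/eqP.
  by apply: eq_bigr => l _; rewrite !mxE.
have zgen j : exists2 g, O g & z j = g * z t.
  exists (\sum_l invmx (1%:M - H) j l * cst (c l)).
    by apply: regular_at_sum => l; apply: regular_atM => //; exists (invmx 1%:M j l); exact: regV.
  have := congr1 (fun w : 'cV[K]_N.+1 => w j 0) zE; rewrite mulmxA.
  by rewrite mxE => ->; rewrite mxE big_ord1 [X in _ * X]mxE mulr1n; congr (_ * _); rewrite mxE; apply: eq_bigr => l _; rewrite mxE.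
exists (z t); first exact: zval.
have gen_sum (h : 'I_N.+1 -> K) : (forall j, O (h j)) -> exists2 g, O g & \sum_j h j * z j = g * z t.
  move=> hO; exists (\sum_j h j * s2val (cid2 (zgen j))).
    by apply: regular_at_sum => j; apply: regular_atM => //; case: cid2.
  rewrite mulr_suml; apply: eq_bigr => j _; rewrite -mulrA; congr (_ * _).
  by case: cid2.
move=> a ma; have [p [q [qv aE rv]]] := O_psi (ex_intro _ 0 ma).
have pv : p.@[v] = 0.
  have /eqP := regval_uniq phiK rv ma.
  by rewrite mulf_eq0 invr_eq0 (negPf qv) orbF => /eqP.
have [h hm hE] := taylor p.
have [j|g Og gE] := gen_sum (fun j => cst (p^`M(j)).@[v] + h j).
  by apply: regular_atD => //; exists 0.
exists ((psi q)^-1 * g).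
  apply: regular_atM => //; exists (q.@[v])^-1; apply: regvalV; first exact: psi_val.
  exact/eqP.
rewrite aE -mulrA -gE mulrC; congr (_ * _).
move/eqP: hE; rewrite pv cst0 subr0 subr_eq => /eqP ->.
by rewrite /Z addrC -big_split; apply: eq_bigr => j _; rewrite mulrDl.
Qed.

(** If [b] were divisible by all the powers of [t], the ideals of those
    polynomials whose image is a multiple of [b / t ^ n] would form an ascending
    chain; once it is stationary, [1 / t] is regular. *)
Let krull t b : t != 0 -> b != 0 -> m t -> exists n, ~ O (b / t ^+ n).
Proof.
move=> t0 b0 mt; apply: contrapT => no.
have Ob n : O (b / t ^+ n) by apply: contrapT => h; apply: no; exists n.
pose J n p := O (psi p * (t ^+ n / b)).
have [] := @ideal_maximal _ _ (fun I => exists n, I = J n).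
- move=> _ [n ->]; split=> [|p q|p q].
  + by rewrite /J -psiE rmorph0 mul0r; exact: regular_at0.
  + by rewrite /J -!psiE rmorphD mulrDl; exact: regular_atD.
  + by rewrite /J -!psiE rmorphM -mulrA; apply: regular_atM; exact: Opsi.
- by exists (J 0%N), 0%N.
move=> _ [n ->] maxJ.
have stat : forall p, J n.+1 p -> J n p.
  apply: maxJ; first by exists n.+1.
  move=> p; rewrite /J exprS => h.
  rewrite [X in O X](_ : _ = t * (psi p * (t ^+ n / b))); last by ring.
  by apply: regular_atM => //; exists 0.
have [p [q [qv bE _]]] := O_psi (Ob n.+1).
have q0 : psi q != 0.
  apply: contraNneq qv => e; apply/eqP; apply: (regval_uniq phiK (psi_val q)).
  by rewrite e; exact: regval0.
have tn0 l : t ^+ l != 0 by exact: expf_neq0.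
have p0 : psi p != 0.
  have := mulf_neq0 b0 (invr_neq0 (tn0 n.+1)); rewrite bE.
  by apply: contraNneq => ->; rewrite mul0r.
have tbE : t ^+ n.+1 / b = psi q / psi p.
  by rewrite -[LHS]invrK invf_div bE invf_div.
have : J n.+1 p by rewrite /J tbE mulrCA divff // mulr1.
move/stat; rewrite /J => h.
have {h} : O (psi q / t).
  move: h; congr O; apply: (mulIf t0); rewrite divfK //.
  rewrite -!mulrA; rewrite [X in _ * X](_ : _ = t ^+ n.+1 / b); last by rewrite exprS; ring.
  by rewrite tbE mulrCA divff // mulr1.
move/(regular_atM (ex_intro _ _ (regvalV (psi_val q) (elimN eqP qv)))).
rewrite mulrA mulVf // mul1r => Ot; have := maxM Ot mt; rewrite mulVf // => m1.
by have /eqP := regval_uniq phiK m1 (regval1 _ x); rewrite eq_sym oner_eq0.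
Qed.

Lemma regular_at_unit a : O a -> ~ m a -> O a^-1.
Proof.
case=> c ac nm; exists c^-1; apply: (regvalV ac) => c0; apply: nm.
by rewrite -c0.
Qed.

(** Every nonzero element of the local ring is a unit times a power of the
    generator of the maximal ideal. *)
Theorem regular_at_valuation a : a != 0 -> O a \/ O a^-1.
Proof.
have [t mt tgen] := max_principal.
have unif b : O b -> b != 0 -> exists n u, [/\ u != 0, O u, O u^-1 & b = u * t ^+ n].
  move=> Ob b0; case: (eqVneq t 0) => [t0|t0].
    exists 0%N, b; split; rewrite ?mulr1 //; apply: regular_at_unit => // /tgen[g _].
    by rewrite t0 mulr0 => e; rewrite e eqxx in b0.
  have tn0 l : t ^+ l != 0 by exact: expf_neq0.
  have exn : exists n, `[< ~ O (b / t ^+ n) >].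
    by have [n nO] := krull t0 b0 mt; exists n; apply/asboolP.
  case: (ex_minnP exn) => [[|n]] /asboolP nO minn; first by case: nO; rewrite divr1.
  have On : O (b / t ^+ n).
    by apply: contrapT => h; have := minn n (introT (asboolP _) h); rewrite ltnn.
  exists n, (b / t ^+ n); split=> //; last by rewrite divfK.
    by rewrite mulf_neq0 ?invr_neq0.
  apply: regular_at_unit => // /tgen[g Og gE]; apply: nO.
  by rewrite exprSr invfM mulrA gE mulfK.
move=> a0; have [d [p [q [_ _ q0 aE]]]] := quot_psi a.
have p0 : psi p != 0 by apply: contraNneq a0 => e; rewrite aE e mul0r.
have [i [u [u0 Ou Ou' uE]]] := unif _ (Opsi p) p0.
have [j [w [w0 Ow Ow' wE]]] := unif _ (Opsi q) q0.
have Ot l : O (t ^+ l).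
  elim: l => [|l IH]; first by rewrite expr0; exact: regular_at1.
  by rewrite exprS; apply: regular_atM => //; exists 0.
have tj0 : t ^+ j != 0 by apply: contraNneq q0 => e; rewrite wE e mulr0.
have ti0 : t ^+ i != 0 by apply: contraNneq p0 => e; rewrite uE e mulr0.
rewrite aE uE wE; case: (leqP j i) => [lji|/ltnW lij]; [left | right].
  rewrite -(subnK lji) exprD mulrA -mulf_div divff // mulr1.
  by apply: regular_atM => //; apply: regular_atM.
rewrite invf_div -(subnK lij) exprD mulrA -mulf_div divff // mulr1.
by apply: regular_atM => //; apply: regular_atM.
Qed.

End LocalRing.

(** * Isotropic subbundles *)

Section Charts.
Variables (F : closedFieldType) (C : curve F) (r : nat) (V : vbundle C r).
Variables (K : fieldType) (phi : {rmorphism {mpoly F[(ambient_dim C).+1]} -> K}).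
Hypothesis phiK : is_function_field phi.
Implicit Types (i j l : chart_index V) (x y : C).
Notation regmx := (regmx phi).

Definition chart_inv i x (w : 'rV[F]_r) : fiber V x :=
  if pselect (exists v, chart i x v = w) is left ex then sval (cid ex) else 0.

Lemma chart_invK i x w : chart_dom i x -> chart i x (chart_inv i x w) = w.
Proof.
move=> ix; have [g _ gK] := chart_bij ix; rewrite /chart_inv.
by case: pselect => [ex|[]]; [case: cid | exists (g w)].
Qed.

Lemma chart_inj i x : chart_dom i x -> injective (chart i x).
Proof. by move=> /chart_bij/bij_inj. Qed.

(** With rational functions in place of functions on the overlap, the cocycle
    identities become identities between matrices over [K]. *)
Definition transition i j (T : 'M[K]_r) : Prop :=
  forall x, chart_dom i x -> chart_dom j x ->
    exists2 B, regmx T x B & forall v, chart j x v = chart i x v *m B.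

Lemma transition_exists i j x y : chart_dom i x -> chart_dom j y -> exists T, transition i j T.
Proof.
move=> ix jy; have [g [rg gP]] := chart_change i j.
have oij := opnI (chart_open i) (chart_open j).
have [z ijz] := opn_meet (chart_open i) (chart_open j) ix jy.
have [T hT] := regmx_of_regular_on phiK oij ijz rg.
exists T => w iw jw; exists (g w); first exact: hT.
exact: gP.
Qed.

Lemma transition_refl i : transition i i 1%:M.
Proof.
by move=> x _ _; exists 1%:M; [exact: regmx1 | move=> v; rewrite mulmx1].
Qed.

Lemma transition_comp i j l x y z T T' T'' :
  chart_dom i x -> chart_dom j y -> chart_dom l z ->
  transition i j T -> transition j l T' -> transition i l T'' -> T'' = T *m T'.
Proof.
move=> ix jy lz hT hT' hT''.
have [w [iw jw]] := opn_meet (chart_open i) (chart_open j) ix jy.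
have [u [[iu ju] lu]] := opn_meet (opnI (chart_open i) (chart_open j)) (chart_open l) (conj iw jw) lz.
apply: (regmx_eq phiK (opnI (opnI (chart_open i) (chart_open j)) (chart_open l)) (conj (conj iu ju) lu)).
move=> t [[it jt] lt].
have [B hB BE] := hT t it jt; have [B' hB' BE'] := hT' t jt lt; have [B'' hB'' BE''] := hT'' t it lt.
exists B''; rewrite // (_ : B'' = B *m B'); first exact: regmx_mul.
apply/row_matrixP => k; rewrite !rowE.
rewrite -[delta_mx 0 k](chart_invK _ it) -BE'' BE' BE.
by rewrite mulmxA.
Qed.

Lemma transition_inv i j x y T T' : chart_dom i x -> chart_dom j y ->
  transition i j T -> transition j i T' -> T *m T' = 1%:M.
Proof.
move=> ix jy hT hT'; apply/esym.
exact: (transition_comp ix jy ix hT hT' (@transition_refl i)).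
Qed.

(** Passing to another chart multiplies by a transition matrix, which is regular
    on the overlap. *)
Lemma regular_section_chart (U : C -> Prop) i (A : 'rV[K]_r) (s : forall x, fiber V x) :
  (forall x, U x -> chart_dom i x) -> (forall x, U x -> regmx A x (chart i x (s x))) ->
  regular_section U s.
Proof.
move=> Ui hA j k x [Ux jx]; have [T hT] := transition_exists (Ui x Ux) jx.
have : regular_on (fun x => U x /\ chart_dom j x) (fun x => chart j x (s x) 0 k).
  apply: (regval_regular_on phiK (a := (A *m T) 0 k)) => y [Uy jy].
  have [B hB ->] := hT y (Ui y Uy) jy.
  exact: (regmx_mul phiK (hA y Uy) hB).
by apply; split.
Qed.

End Charts.

Section Saturated.
Variables (F : closedFieldType) (C : curve F) (r n : nat) (V : vbundle C r).
Variables (K : fieldType) (phi : {rmorphism {mpoly F[(ambient_dim C).+1]} -> K}).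
Hypothesis phiK : is_function_field phi.
Implicit Types (i j : chart_index V) (x y : C).
Notation regmx := (regmx phi).
Notation transition := (transition phi).
Variables (i0 : chart_index V) (x0 : C) (W : 'M[K]_(n, r)).
Hypotheses (i0x0 : chart_dom i0 x0) (freeW : row_free W).

(** The fibre at [x] of the saturation. The rows of [W] are rational sections
    read in the chart [i0]; the transition [T] is needed since [x] may lie
    outside the domain of [i0]. *)
Definition section_value x (v : fiber V x) : Prop :=
  exists i a T, [/\ chart_dom i x, transition i0 i T & regmx (a *m W *m T) x (chart i x v)].

(** The identity submatrix ensures that [B y] has rank [n], and exhibits the
    coefficients of a combination of rows among its entries. *)
Definition local_frame (U : C -> Prop) i (A : 'M[K]_(n, r)) (B : C -> 'M[F]_(n, r)) : Prop :=
  [/\ opn U, forall y, U y -> chart_dom i y,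
      exists P T, [/\ P \in unitmx, transition i0 i T & A = P *m W *m T],
      forall y, U y -> regmx A y (B y) &
      exists f, forall y, U y -> colsub f (B y) = 1%:M].

Lemma local_frame_exists x : exists U i A B, U x /\ local_frame U i A B.
Proof.
have [i ix] := chart_cover V x.
have [T hT] := transition_exists phiK i0x0 ix.
have [T' hT'] := transition_exists phiK ix i0x0.
have TT' := transition_inv phiK i0x0 ix hT hT'.
have freeWT : row_free (W *m T).
  by rewrite /row_free mxrankMfree //; apply/row_freeP; exists T'.
have [P uP [OP [f fP]]] := saturation (@regular_at0 _ _ _ phi x) (@regular_at1 _ _ _ phi x)
  (@regular_atM _ _ _ phi x) (fun a => @regular_at_valuation _ _ _ _ phiK x a) freeWT.
rewrite mulmxA in OP fP; move: {-2}(P *m W *m T) (erefl (P *m W *m T)) OP fP => A AE OP fP.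
have ex_nbhd k : exists U : C -> Prop, [/\ opn U, U x &
    forall y, U y -> forall l, regular_at phi y (A k l)].
  have ex l : exists U : C -> Prop, [/\ opn U, U x & forall y, U y -> regular_at phi y (A k l)].
    have [c /regval_opn[U [oU Ux [d [p [q [_ _ UP]]]]]]] := OP k l.
    by exists U; split=> // y /UP[_ h]; exists (ev p y / ev q y).
  exists (fun y => forall l, sval (cid (ex l)) y); split=> [|l|y h l].
  - by apply: opn_forall => l; case: cid => U /= [].
  - by case: cid => U /= [].
  - by move: (h l); case: cid => U /= [_ _]; apply.
pose U y := (forall k, sval (cid (ex_nbhd k)) y) /\ chart_dom i y.
have UP y : U y -> forall k l, regular_at phi y (A k l).
  by move=> [h _] k; move: (h k); case: cid => U' /= [_ _ H]; exact: H.
pose B y : 'M[F]_(n, r) := \matrix_(k, l)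
  if pselect (regular_at phi y (A k l)) is left ex then sval (cid ex) else 0.
have hB y : U y -> regmx A y (B y).
  by move=> Uy k l; rewrite mxE; case: pselect => [ex|[]]; [case: cid | exact: UP].
exists U, i, A, B; split.
  by split=> // k; case: cid => U' /= [].
split=> //.
- apply: opnI (chart_open i); apply: opn_forall => k.
  by case: cid => U' /= [].
- by move=> y [].
- by exists P, T; split.
exists f => y Uy; have h1 := @regmx1 _ _ _ phi n y.
apply: (regmx_uniq phiK _ h1) => k l.
by rewrite -fP !mxE; have := hB y Uy k (f l); rewrite !mxE.
Qed.

Lemma section_valueP U i A B y v : local_frame U i A B -> U y ->
  @section_value y v <-> exists c : 'rV[F]_n, chart i y v = c *m B y.
Proof.
case=> oU Ui [P [T [uP hT AE]]] hB [f fB] Uy; have iy := Ui y Uy; split; last first.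
  case=> c vE; exists i, (map_mx (const_fun phi) c *m P), T; split=> //.
  rewrite vE -!mulmxA [P *m _]mulmxA -AE.
  by apply: regmx_mul => //; [exact: regmx_cst | exact: hB].
case=> j [a [T' [jy hT' hv]]].
have [H hH] := transition_exists phiK jy iy.
have TE := transition_comp phiK i0x0 jy iy hT' hH hT.
have [BH hBH HE] := hH y jy iy.
have hvi : regmx (a *m invmx P *m A) y (chart i y v).
  by rewrite AE TE HE !mulmxA mulmxKV //; apply: regmx_mul.
have fA : colsub f A = 1%:M.
  apply: (regmx_eq phiK oU Uy) => z Uz; exists 1%:M; last exact: regmx1.
  by rewrite -(fB z Uz) => k l; rewrite !mxE; exact: hB.
have hc : regmx (a *m invmx P) y (colsub f (chart i y v)).
  have fD (D : 'rV[K]_n) k l : (D *m A) k (f l) = D k l.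
    rewrite -[in RHS](mulmx1 D) -fA !mxE; apply: eq_bigr => t _.
    by rewrite mxE.
  by move=> k l; rewrite -fD [colsub _ _ _ _]mxE; exact: hvi.
exists (colsub f (chart i y v)).
apply: (regmx_uniq phiK hvi); apply: regmx_mul => //; exact: hB.
Qed.

Lemma span_tupleP (U : vectType F) m (s : 'I_m -> U) u :
  u \in <<[tuple s k | k < m]>>%VS <-> exists c : 'rV[F]_m, u = \sum_k c 0 k *: s k.
Proof.
split=> [/coord_span ->|[c ->]].
  exists (\row_k coord [tuple s k | k < m] k u).
  by apply: eq_bigr => k _; rewrite mxE -tnth_nth tnth_mktuple.
apply: memv_suml => k _; apply: memvZ; apply: memv_span.
by apply/tnthP; exists k; rewrite tnth_mktuple.
Qed.

Lemma chart_comb i y (s : 'I_n -> fiber V y) (B : 'M[F]_(n, r)) (c : 'rV[F]_n) :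
  (forall k, chart i y (s k) = row k B) -> chart i y (\sum_k c 0 k *: s k) = c *m B.
Proof.
move=> sB; rewrite linear_sum /= mulmx_sum_row; apply: eq_bigr => k _.
by rewrite linearZ /= sB.
Qed.

Definition frame_section i (B : C -> 'M[F]_(n, r)) k y : fiber V y :=
  chart_inv i y (row k (B y)).

Lemma section_value_span U i A B y v : local_frame U i A B -> U y ->
  v \in <<[tuple frame_section i B k y | k < n]>>%VS <-> @section_value y v.
Proof.
move=> fr Uy; have iy : chart_dom i y by case: fr => _ /(_ y Uy).
have sB k : chart i y (frame_section i B k y) = row k (B y) by exact: chart_invK.
apply: iff_trans (span_tupleP _ _) _; apply: iff_trans (iff_sym (section_valueP v fr Uy)).
split=> [[c ->]|[c vE]]; exists c; first exact: chart_comb.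
by apply: (chart_inj iy); rewrite vE (chart_comb _ sB).
Qed.

(** Near each point, a combination of the rows of a local frame is regular if
    and only if its coefficients are, so that the fibres are spanned by the
    values of the frame. *)
Lemma saturated_subbundle : exists2 E : forall x, {vspace fiber V x},
  subbundle n E & forall x v, v \in E x <-> section_value v.
Proof.
have exE x : exists E : {vspace fiber V x}, forall v, v \in E <-> section_value v.
  have [U [i [A [B [Ux fr]]]]] := local_frame_exists x.
  by exists <<[tuple frame_section i B k x | k < n]>>%VS => v; exact: section_value_span fr Ux.
pose E x := sval (cid (exE x)).
have EP x v : v \in E x <-> section_value v by exact: (svalP (cid (exE x))).
exists E => // x.
have [U [i [A [B [Ux fr]]]]] := local_frame_exists x.
case: (fr) => oU Ui _ hB [f fB].
exists U; split=> //; exists (frame_section i B); split=> [k|y Uy].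
  apply: (regular_section_chart phiK (i := i) (A := row k A)) => // y Uy k' l.
  by rewrite ord1 chart_invK; [rewrite !mxE; exact: hB | exact: Ui].
have iy := Ui y Uy.
have sB k : chart i y (frame_section i B k y) = row k (B y) by exact: chart_invK.
apply/andP; split.
  apply/eqP/vspaceP => v; apply/idP/idP.
    by move/(section_value_span _ fr Uy)/EP.
  by move/EP/(section_value_span _ fr Uy).
apply/freeP => c c0 k.
pose d : 'rV[F]_n := \row_k c k.
have : d *m B y = 0.
  rewrite -(chart_comb d sB) (_ : \sum_k d 0 k *: _ = 0) ?linear0 // -[RHS]c0.
  by apply: eq_bigr => k' _; rewrite mxE -tnth_nth tnth_mktuple.
move=> dB; have : d = 0.
  have colsubM (D : 'rV[F]_n) (M : 'M[F]_(n, r)) : D *m colsub f M = colsub f (D *m M).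
    by apply/matrixP => a b; rewrite !mxE; apply: eq_bigr => t _; rewrite !mxE.
  rewrite -[d]mulmx1 -(fB y Uy) colsubM dB.
  by apply/matrixP => a b; rewrite !mxE.
by move/rowP/(_ k); rewrite !mxE.
Qed.

End Saturated.

Section Isotropy.
Variables (F : closedFieldType) (C : curve F) (L : vbundle C 1) (r : nat).
Variable V : orthogonal_bundle L r.
Notation E := (obundle V).
Variables (K : fieldType) (phi : {rmorphism {mpoly F[(ambient_dim C).+1]} -> K}).
Hypothesis phiK : is_function_field phi.
Notation regmx := (regmx phi).
Variables (i0 : chart_index E) (j0 : chart_index L) (x0 : C).
Hypotheses (i0x0 : chart_dom i0 x0) (j0x0 : chart_dom j0 x0).

Let U0 x := chart_dom i0 x /\ chart_dom j0 x.

Let oU0 : opn U0. Proof. exact: opnI (chart_open i0) (chart_open j0). Qed.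

Let frame k x : fiber E x := chart_inv i0 x (delta_mx 0 k).

Let gram x : 'M[F]_r := \matrix_(k, l) chart j0 x (oform V x (frame k x) (frame l x)) 0 0.

Let gramP x (u v : fiber E x) : chart_dom i0 x ->
  chart j0 x (oform V x u v) = chart i0 x u *m gram x *m (chart i0 x v)^T.
Proof.
move=> ix.
have frameE w : w = \sum_k chart i0 x w 0 k *: frame k x.
  apply: (chart_inj ix); rewrite linear_sum /= {1}[chart i0 x w]row_sum_delta.
  by apply: eq_bigr => k _; rewrite linearZ /= chart_invK.
apply/rowP => a; rewrite ord1 {1}(frameE u) linear_sumlz linear_sum summxE /=.
rewrite -mulmxA mxE; apply: eq_bigr => k _.
rewrite linearZl_LR linearZ mxE /=; congr (_ * _).
rewrite {1}(frameE v) linear_sumr linear_sum summxE mxE /=; apply: eq_bigr => l _.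
by rewrite linearZr_LR linearZ !mxE mulrC.
Qed.

(** The entries of the Gram matrix are regular on [U0], being values of the form
    on regular sections. *)
Lemma gram_matrix : exists G : 'M[K]_r, G^T = G /\ forall x, U0 x -> regmx G x (gram x).
Proof.
have regfr k : regular_section U0 (frame k).
  apply: (regular_section_chart phiK (i := i0) (A := delta_mx 0 k)) => [x []//|x [ix _]].
  rewrite chart_invK // => a b; rewrite !mxE.
  by case: (_ && _); [exact: regval1 | exact: regval0].
have reg k l : regular_on U0 (fun x => gram x k l).
  move=> x Ux; have := oform_regular oU0 (regfr k) (regfr l) (i:=j0) 0.
  move=> /(_ x (conj Ux Ux.2))[W [oW Wx [d [p [q [hp hq WP]]]]]].
  exists W; split=> //; exists d, p, q; split=> // y Wy Uy.
  by rewrite mxE; apply: WP => //; split=> //; case: Uy.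
have [G hG] := regmx_of_regular_on phiK oU0 (conj i0x0 j0x0) reg.
exists G; split=> //.
apply: (regmx_eq phiK oU0 (conj i0x0 j0x0)) => x Ux; exists (gram x); last exact: hG.
have -> : gram x = (gram x)^T by apply/matrixP => k l; rewrite !mxE oform_sym.
by apply: regmx_tr; exact: hG.
Qed.

(** Isotropy of the generic fibre passes to all the fibres, because the value
    of the form on two regular sections is a regular function. *)
Lemma section_value_isotropic n (W : 'M[K]_(n, r)) (G : 'M[K]_r) :
  row_free W -> (forall x, U0 x -> regmx G x (gram x)) -> W *m G *m W^T = 0 ->
  forall x (u v : fiber E x), section_value phi i0 W u -> section_value phi i0 W v ->
  oform V x u v = 0.
Proof.
move=> freeW hG WG x u v su sv.
have [U [i [A [B [Ux fr]]]]] := local_frame_exists phiK i0x0 freeW x.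
have [c uE] := (section_valueP phiK i0x0 u fr Ux).1 su.
have [d vE] := (section_valueP phiK i0x0 v fr Ux).1 sv.
case: fr => oU Ui [P [T [uP hT AE]]] hB _.
pose s (c : 'rV[F]_n) y : fiber E y := chart_inv i y (c *m B y).
have sE c' y : U y -> chart i y (s c' y) = c' *m B y by move=> Uy; apply: chart_invK; exact: Ui.
have regs c' : regular_section U (s c').
  apply: (regular_section_chart phiK (i := i) (A := map_mx (const_fun phi) c' *m A)) => // y Uy.
  by rewrite sE //; apply: regmx_mul (hB y Uy) => //; exact: regmx_cst.
have [j jx] := chart_cover L x.
have oUj := opnI oU (chart_open j).
have reg := oform_regular oU (regs c) (regs d) (i:=j) 0.
have [a ha] := regular_on_regval phiK oUj (conj Ux jx) reg.
have ix := Ui x Ux.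
have [H hH] := transition_exists phiK ix i0x0.
have TH := transition_inv phiK i0x0 ix hT hH.
have [y [[Uy jy] [i0y j0y]]] := opn_meet oUj oU0 (conj Ux jx) (conj i0x0 j0x0).
have a0 : a = 0.
  apply: (regval_eq0 phiK (opnI oUj oU0) (conj (conj Uy jy) (conj i0y j0y))).
  move=> z [[Uz jz] [i0z j0z]].
  have [BH hBH HE] := hH z (Ui z Uz) i0z.
  have hs c' : regmx (map_mx (const_fun phi) c' *m (P *m W)) z (chart i0 z (s c' z)).
    have -> : P *m W = A *m H by rewrite AE -(mulmxA (P *m W)) TH mulmx1.
    rewrite HE sE // -mulmxA.
    by apply: regmx_mul => //; [exact: regmx_cst | apply: regmx_mul => //; exact: hB].
  have h0 : regmx (0 : 'M[K]_1) z (chart j0 z (oform V z (s c z) (s d z))).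
    rewrite gramP //.
    have -> : 0 = map_mx (const_fun phi) c *m (P *m W) *m G *m (map_mx (const_fun phi) d *m (P *m W))^T.
      set c' := map_mx _ c; set d' := map_mx _ d.
      have -> : c' *m (P *m W) *m G *m (d' *m (P *m W))^T = c' *m P *m (W *m G *m W^T) *m (P^T *m d'^T).
        by rewrite !trmx_mul !mulmxA.
      by rewrite WG mulmx0 mul0mx.
    apply: regmx_mul (regmx_tr (hs d)) => //; apply: regmx_mul (hG z (conj i0z j0z)) => //; exact: hs.
  have o0 : oform V z (s c z) (s d z) = 0.
    apply: (chart_inj j0z); rewrite linear0; apply: (regmx_uniq phiK h0).
    by move=> k l; rewrite !mxE; exact: regval0.
  by have := ha z (conj Uz jz); rewrite o0 linear0 mxE.
have suE : s c x = u by apply: (chart_inj ix); rewrite sE.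
have svE : s d x = v by apply: (chart_inj ix); rewrite sE.
apply: (chart_inj jx); rewrite linear0; apply/rowP => k; rewrite ord1 mxE.
have := ha x (conj Ux jx); rewrite suE svE a0 => h.
by rewrite (regval_uniq phiK h (regval0 phi x)).
Qed.

End Isotropy.

Lemma isotropic_subbundle_exists (F : closedFieldType) (C : curve F) (L : vbundle C 1)
    (n : nat) (V : orthogonal_bundle L (2 * n).+1) :
  exists E : forall x : C, {vspace fiber (obundle V) x},
    subbundle n E /\ isotropic (V := V) E.
Proof.
have [x0 _] := curve_nonempty C.
have [K [phi phiK]] := function_field_exists C.
have [i0 i0x0] := chart_cover (obundle V) x0.
have [j0 j0x0] := chart_cover L x0.
have [G [symG hG]] := gram_matrix phiK i0x0 j0x0.
have [W freeW WG] := isotropic_subspace_exists (tsen_ternary phiK) symG.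
have [E subE EP] := saturated_subbundle phiK i0x0 freeW.
exists E; split=> // x u v /EP su /EP sv.
exact: (section_value_isotropic phiK i0x0 j0x0 freeW hG WG su sv).
Qed.

Theorem lemma2p7 (R : realType) (C : curve (complex R)) (g : nat)
    (Hgenus : has_genus C g) (Hg : (2 <= g)%N)
    (L : vbundle C 1) (n : nat) (V : orthogonal_bundle L (2 * n).+1) :
  exists E : forall x : C, {vspace fiber (obundle V) x},
    subbundle n E /\ isotropic (V := V) E.
Proof. exact: isotropic_subbundle_exists. Qed.
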